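(* Let $M$ be a compact Riemannian manifold, let $X$ be a flow (i.e. a $C^1$ vector field) on $M$, and let $\Lambda\subset M$ be a compact invariant set of $X$ which is both positively and negatively sectional-hyperbolic. Then $\Lambda$ is the disjoint union $\Lambda=H\sqcup S\sqcup R$ of a (possibly empty) hyperbolic set $H$ of $X$ containing no singularities of $X$, a (possibly empty) finite set $S$ of singularities of $X$, and a (possibly empty) set $R$ of regular points (points that are not singularities of $X$) such that $\alpha(x)\subset H\cup S$ and $\omega(x)\subset H\cup S$ for every $x\in R$.
   Context: $M$ has Riemannian metric $\langle\cdot,\cdot\rangle$ and induced norm $\|\cdot\|$. A flow is a $C^1$ vector field $X$ on $M$, with induced flow $X_t$; $-X$ is the reversed flow. Singularities of $X$ are its zeroes. A set $\Lambda$ is invariant if $X_t(\Lambda)=\Lambda$ for all $t\in\mathbb{R}$. $\omega(x)$ is the set of $y\in M$ with $y=\lim_n X_{t_n}(x)$ for some $t_n\to\infty$; $\alpha(x)$ is the $\omega$-limit set of $x$ for $-X$. Hyperbolic: a compact invariant set $\Lambda$ is hyperbolic if there are a continuous $DX_t$-invariant splitting $T_\Lambda M=E^s\oplus E^X\oplus E^u$ and $K,\lambda>0$ such that (1) $E^s$ is contracting: $\|DX_t(x)v\|\le Ke^{-\lambda t}\|v\|$ for all $x\in\Lambda$, $v\in E^s_x$, $t\ge0$; (2) $E^X_x$ is the subspace of $T_xM$ generated by $X(x)$; (3) $E^u$ is expanding: $\|DX_t(x)v\|\ge K^{-1}e^{\lambda t}\|v\|$ for all $x\in\Lambda$, $v\in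 E^u_x$, $t\ge0$. Subbundles may be zero. A singularity $\sigma$ is hyperbolic if $\{\sigma\}$ is a hyperbolic set. Dominated splitting: a compact invariant set $\Lambda$ has a dominated splitting with respect to the tangent flow if there are a $DX_t$-invariant splitting into subbundles $T_\Lambda M=E\oplus F$ and $K,\lambda>0$ with $\|DX_t(x)e\|\cdot\|f\|\le Ke^{-\lambda t}\|DX_t(x)f\|\cdot\|e\|$ for all $x\in\Lambda$, $t\ge0$, $(e,f)\in E_x\times F_x$ (either subbundle may be zero). It is a partially hyperbolic splitting if moreover $E$ is contracting. For $u,v\in T_pM$ let $\|u,v\|=\sqrt{\langle u,u\rangle\langle v,v\rangle-\langle u,v\rangle^2}$ (area of the parallelogram spanned by $u,v$). $F$ is sectionally expanding if there are $K,\lambda>0$ with $\|DX_t(x)u,DX_t(x)v\|\ge K^{-1}e^{\lambda t}\|u,v\|$ for all $x\in\Lambda$, $u,v\in F_x$, $t\ge0$. A sectional-hyperbolic splitting for $X$ over $\Lambda$ is a partially hyperbolic splitting $T_\Lambda M=E\oplus F$ with $F$ sectionally expanding. A compact invariant set $\Lambda$ is sectional-hyperbolic for $X$ if every singularity of $X$ in $\Lambda$ is hyperbolic and there is a sectional-hyperbolic splitting for $X$ over $\Lambda$. It is positively (resp. negatively) sectional-hyperbolic if it is sectional-hyperbolic for $X$ (resp. for $-X$). *)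

(* Defs.v *)
From HB Require Import structures.
From mathcomp Require Import all_boot all_order all_algebra.
From mathcomp Require Import all_classical all_reals all_analysis.

Set Implicit Arguments.
Unset Strict Implicit.
Unset Printing Implicit Defensive.

Import Order.TTheory GRing.Theory Num.Theory.
Import numFieldNormedType.Exports.

Local Open Scope classical_set_scope.
Local Open Scope ring_scope.

(* [O] is meant to be open. The induction runs through the maps
   [x |-> 'd f x v] for fixed [v], which in finite dimension is equivalent to
   [x |-> 'd f x] being of class C^k. *)
Fixpoint class_C (R : realType) (U V : normedModType R) (k : nat)
    (O : set U) (f : U -> V) : Prop :=
  match k with
  | 0 => forall x, O x -> {for x, continuous f}
  | k'.+1 => (forall x, O x -> differentiable f x) /\
             forall v : U, class_C k' O (fun x => 'd f x v)
  end.

Definition smooth (R : realType) (U V : normedModType R)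
    (O : set U) (f : U -> V) : Prop := forall k, class_C k O f.

(* Smooth n-manifolds without boundary, not necessarily connected. The atlas is
   indexed by the points of the manifold, the chart of index [c] being defined
   at [c]; every smooth structure has such an atlas. [parm c] is the inverse of
   [chart c]; the values of [chart c] and [parm c] outside [dom c] and outside
   [chart c @` dom c] are irrelevant. *)
Record manifold (R : realType) (n : nat) := Manifold {
  carrier :> topologicalType;
  manifold_hausdorff : hausdorff_space carrier;
  manifold_second_countable : @second_countable carrier;
  dom : carrier -> set carrier;
  chart : carrier -> carrier -> 'rV[R]_n;
  parm : carrier -> 'rV[R]_n -> carrier;
  dom_open : forall c, open (dom c);
  dom_self : forall c, dom c c;
  chart_open : forall c, open (chart c @` dom c);
  chartK : forall c x, dom c x -> parm c (chart c x) = x;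
  chart_continuous : forall c x, dom c x -> {for x, continuous (chart c)};
  parm_continuous : forall c y, (chart c @` dom c) y ->
    {for y, continuous (parm c)};
  transition_smooth : forall c d,
    smooth (chart c @` (dom c `&` dom d)) (chart d \o parm c)
}.

Section Manifold.
Context (R : realType) (n : nat) (M : manifold R n).
Local Notation V := 'rV[R]_n.

Implicit Types (c d x : M) (u v w : V) (t : R) (L : set M).

Definition chart_img (c : M) : set V := chart c @` dom c.

(* A tangent vector at [x] is represented by its coordinates in the chart of
   index [x], so that every T_x M is a copy of [V]. [change c d x] sends the
   coordinates in the chart [c] of a tangent vector at [x] to its coordinates
   in the chart [d]. *)
Definition change (c d x : M) : V -> V := 'd (chart d \o parm c) (chart c x).

Definition tangent_map (f : M -> M) (x : M) : V -> V :=
  'd (chart (f x) \o f \o parm x) (chart x x).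

Record riemannian_metric := RiemannianMetric {
  inner :> M -> V -> V -> R;
  inner_sym : forall x u v, inner x u v = inner x v u;
  inner_linear : forall x (a : R) u v w,
    inner x (a *: u + v) w = a * inner x u w + inner x v w;
  inner_pos : forall x u, u != 0 -> 0 < inner x u u;
  inner_smooth : forall c u v, smooth (chart_img c)
    (fun y => let x := parm c y in
       inner x (change c x x u) (change c x x v) : R^o)
}.

Definition C1_vector_field (X : M -> V) : Prop :=
  forall c, class_C 1 (chart_img c)
    (fun y => let x := parm c y in change x c x (X x)).

Definition singular (X : M -> V) : set M := [set x | X x = 0].

(* [Xt] is the flow induced by [X]: the C^1 one-parameter group of
   transformations of M whose infinitesimal generator is [X]. *)
Record induced_flow (X : M -> V) (Xt : R -> M -> M) : Prop := InducedFlow {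
  flow0 : forall x, Xt 0 x = x;
  flowD : forall s t x, Xt (s + t) x = Xt s (Xt t x);
  flow_continuous : continuous (fun p : R * M => Xt p.1 p.2);
  flow_C1 : forall c d, class_C 1
    [set p : R^o * V | chart_img c p.2 /\ dom d (Xt p.1 (parm c p.2))]
    (fun p : R^o * V => chart d (Xt p.1 (parm c p.2)));
  flow_generator : forall x,
    is_derive (0 : R^o) 1 (fun t : R^o => chart x (Xt t x)) (X x)
}.

Definition rev_field (X : M -> V) : M -> V := fun x => - X x.
Definition rev_flow (Xt : R -> M -> M) : R -> M -> M := fun t => Xt (- t).

Definition omega_limit (Xt : R -> M -> M) (x : M) : set M :=
  [set y | exists2 s : nat -> R,
     s @ \oo --> +oo & (fun k => Xt (s k) x) @ \oo --> y].

Definition alpha_limit (Xt : R -> M -> M) : M -> set M :=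
  omega_limit (rev_flow Xt).

Definition compact_invariant (Xt : R -> M -> M) L : Prop :=
  compact L /\ forall t, Xt t @` L = L.

(* A subbundle of T_L M: a field of subspaces that is locally spanned by a
   continuous frame; in particular its rank is locally constant on [L]. *)
Definition subbundle L (E : M -> {vspace V}) : Prop :=
  forall x, L x -> exists (U : set M) (k : nat) (e : M -> k.-tuple V),
    [/\ open U, U x, U `<=` dom x,
        forall q, L q -> U q -> basis_of (E q) (e q)
      & forall j : 'I_k,
          {within L `&` U, continuous (fun q => change q x q (tnth (e q) j))}].

Definition invariant_subbundle (Xt : R -> M -> M) L (E : M -> {vspace V}) :
    Prop :=
  subbundle L E /\
  forall x t, L x ->
    tangent_map (Xt t) x @` [set v | v \in E x] = [set w | w \in E (Xt t x)].

Section Hyperbolicity.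
Variable g : riemannian_metric.

Definition tnorm (x : M) (v : V) : R := Num.sqrt (g x v v).

Definition area (x : M) (u v : V) : R :=
  Num.sqrt (g x u u * g x v v - g x u v ^+ 2).

Definition contracting_with (Xt : R -> M -> M) L (E : M -> {vspace V})
    (K l : R) : Prop :=
  forall x v t, L x -> v \in E x -> 0 <= t ->
    tnorm (Xt t x) (tangent_map (Xt t) x v) <= K * expR (- l * t) * tnorm x v.

Definition expanding_with (Xt : R -> M -> M) L (E : M -> {vspace V})
    (K l : R) : Prop :=
  forall x v t, L x -> v \in E x -> 0 <= t ->
    K^-1 * expR (l * t) * tnorm x v <= tnorm (Xt t x) (tangent_map (Xt t) x v).

Definition contracting Xt L E : Prop :=
  exists K l : R, [/\ 0 < K, 0 < l & contracting_with Xt L E K l].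

Definition flow_direction (X : M -> V) : M -> {vspace V} := fun x => <[X x]>%VS.

Definition hyperbolic_set (X : M -> V) (Xt : R -> M -> M) L : Prop :=
  compact_invariant Xt L /\
  exists (Es Eu : M -> {vspace V}) (K l : R),
    let EX := flow_direction X in
    [/\ [/\ invariant_subbundle Xt L Es, invariant_subbundle Xt L EX
          & invariant_subbundle Xt L Eu],
        forall x, L x -> directv (Es x + EX x + Eu x)%VS /\
                         (Es x + EX x + Eu x)%VS = fullv,
        0 < K /\ 0 < l,
        contracting_with Xt L Es K l
      & expanding_with Xt L Eu K l].

Definition hyperbolic_singularity (X : M -> V) (Xt : R -> M -> M) (x : M) :
    Prop :=
  singular X x /\ hyperbolic_set X Xt [set x].

Definition dominated_splitting (Xt : R -> M -> M) L (E F : M -> {vspace V}) :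
    Prop :=
  [/\ invariant_subbundle Xt L E, invariant_subbundle Xt L F,
      forall x, L x -> directv (E x + F x)%VS /\ (E x + F x)%VS = fullv
    & exists K l : R, [/\ 0 < K, 0 < l
      & forall x t e f, L x -> 0 <= t -> e \in E x -> f \in F x ->
        tnorm (Xt t x) (tangent_map (Xt t) x e) * tnorm x f <=
        K * expR (- l * t) *
          tnorm (Xt t x) (tangent_map (Xt t) x f) * tnorm x e]].

Definition partially_hyperbolic_splitting Xt L E F : Prop :=
  dominated_splitting Xt L E F /\ contracting Xt L E.

Definition sectionally_expanding (Xt : R -> M -> M) L (F : M -> {vspace V}) :
    Prop :=
  exists K l : R, [/\ 0 < K, 0 < l
    & forall x t u v, L x -> 0 <= t -> u \in F x -> v \in F x ->
      K^-1 * expR (l * t) * area x u v <=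
      area (Xt t x) (tangent_map (Xt t) x u) (tangent_map (Xt t) x v)].

Definition sectional_hyperbolic_splitting Xt L E F : Prop :=
  partially_hyperbolic_splitting Xt L E F /\ sectionally_expanding Xt L F.

Definition sectional_hyperbolic (X : M -> V) (Xt : R -> M -> M) L : Prop :=
  [/\ compact_invariant Xt L,
      forall x, L x -> singular X x -> hyperbolic_singularity X Xt x
    & exists E F, sectional_hyperbolic_splitting Xt L E F].

Definition positively_sectional_hyperbolic (X : M -> V) (Xt : R -> M -> M) L :
    Prop :=
  sectional_hyperbolic X Xt L.

Definition negatively_sectional_hyperbolic (X : M -> V) (Xt : R -> M -> M) L :
    Prop :=
  sectional_hyperbolic (rev_field X) (rev_flow Xt) L.

End Hyperbolicity.
End Manifold.

(* Main.v *)
Require Import Defs.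
From HB Require Import structures.
From mathcomp Require Import all_boot all_order all_algebra.
From mathcomp Require Import all_classical all_reals all_analysis.
From mathcomp Require Import ring lra.

Set Implicit Arguments.
Unset Strict Implicit.
Unset Printing Implicit Defensive.

Import Order.TTheory GRing.Theory Num.Theory.
Import numFieldNormedType.Exports.

Local Open Scope classical_set_scope.
Local Open Scope ring_scope.

(** Write [E + F] for the splitting given by sectional hyperbolicity for [X] and
    [E' + F'] for the one given for [-X].

    A vector with a non-zero [E]-part grows without bound in the past: its
    [E]-part does, because [E] is contracted, and domination makes the [F]-part
    at most half as long as the [E]-part (lemma [backward_growth]). Now [X] is
    carried to itself by the tangent flow and is bounded because [M] is compact,
    so [X] lies in [F], and by symmetry in [F']. Likewise vectors of [E] are
    bounded in the future, so [E] is contained in [F'], and [E'] in [F]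
    ([stable_sub_center]). With [C] the intersection of [F] and [F'], this gives
    [T M = E + C + E'] over [Lambda] ([center_directv]). Areas inside [C] would
    have to grow both in the future and in the past, so [C] has dimension at most
    one ([area_center_eq0]), and it is the flow direction wherever [X] is not
    zero. Consequently every compact invariant subset of [Lambda] without
    singularities is hyperbolic, with [E] and [E'] as stable and unstable bundles
    ([hyperbolic_regular]).

    What remains is to understand [Lambda] near one of its singularities [p].
    At a point of [Lambda] near [p] the field lies in [C], which is close to its
    value [C p] at [p]; integrating, the displacement [X_T q - q] of a point [q]
    of [Lambda] near [p] almost lies in [C p]. This displacement is also, to
    first order, the image of [q - p] by [DX_T - 1]. The latter is injective
    modulo [C p], since the contracted bundles [E] and [E'] contain no non-zero
    fixed vector. Hence [q - p] itself almost lies in [C p]. As [p] is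
    hyperbolic, [DX_T] at least halves the vectors of [C p] for some [T], positive
    or negative ([center_rate]); for this [T] the map [X_T] brings every point of
    [Lambda] near [p] closer to [p] by a definite factor ([local_contraction]).
    So [p] has a neighbourhood [U p] in which it attracts [Lambda], either in the
    future or in the past ([trap], [singularity_trap]). It is the only
    singularity of [Lambda] in [U p], and by compactness [Lambda] has only
    finitely many singularities.

    Take for [S] the singularities in [Lambda], for [H] the points of [Lambda]
    whose orbit never enters any [U p], and for [Reg] all the others. [H] is
    compact, invariant and without singularities, hence hyperbolic. Let [x] be
    in [Reg] and [y] in its omega-limit set, and suppose that the orbit of [y]
    enters [U p]; then so does the orbit of [x], at arbitrarily late times. If
    [p] attracts in the future, the orbit of [x] converges to [p], and [y = p].
    If [p] attracts in the past, [x] is reached from [U p] by going back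
    arbitrarily long, and [x = p], which is impossible ([omega_limit_trap]).
    Reversing time deals with the alpha-limit sets. *)

(** * Differential calculus in normed spaces *)

Lemma diff_near_eq (R : numFieldType) (U W : normedModType R) (f h : U -> W)
    (x : U) :
  differentiable f x -> (\forall y \near x, f y = h y) ->
  differentiable h x /\ forall v, 'd h x v = 'd f x v.
Proof.
move=> df fh.
have hlin : h \o shift x = cst (h x) + 'd f x +o_ 0 id.
  have /diff_locally/eqaddoP df0 := df.
  apply/eqaddoE; apply/eqaddoP => _/posnumP[e].
  have e0 := [gt0 of e%:num].
  have fh0 : \forall y \near 0, f (y + x) = h (y + x).
    have := fh; rewrite (near_shift 0); apply: filterS => y /=.
    by rewrite subr0.
  have := df0 _ e0; apply: filterS2 fh0 => y fhy /=.
  by rewrite /= /shift !fctE /= fhy (nbhs_singleton fh).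
have dE : 'd h x = 'd f x :> (U -> W).
  by apply: diff_unique => //; exact: diff_continuous.
split=> [|v]; last by rewrite dE.
apply/diff_locallyP; rewrite dE; split=> //; exact: diff_continuous.
Qed.

Lemma diff_comp_app (R : numFieldType) (U V W : normedModType R) (f : U -> V)
    (h : V -> W) x v :
  differentiable f x -> differentiable h (f x) ->
  'd (h \o f) x v = 'd h (f x) ('d f x v).
Proof. by move=> df dh; rewrite diff_comp. Qed.

Lemma is_derive_comp_diff (R : numFieldType) (U W : normedModType R)
    (h : R^o -> U) (f : U -> W) (t : R^o) (w : U) :
  is_derive t 1 h w -> differentiable f (h t) ->
  is_derive t 1 (f \o h) ('d f (h t) w).
Proof.
move=> [dh hw] df.
have diffh : differentiable h t by apply/derivable1_diffP.
have dfh := differentiable_comp diffh df.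
apply: DeriveDef; first exact: diff_derivable.
by rewrite deriveE // diff_comp //= -hw [in RHS]deriveE.
Qed.

Lemma diff_approx (R : realType) (U W : normedModType R) (f : U -> W) (x : U)
    (e : R) : differentiable f x -> 0 < e ->
  \forall y \near x, `|f y - f x - 'd f x (y - x)| <= e * `|y - x|.
Proof.
move=> df e0; have /diff_locally/eqaddoP/(_ _ e0) := df.
rewrite (near_shift 0 x); apply: filterS => y.
by rewrite /= !fctE /= subr0 addrK opprD addrA.
Qed.

Lemma diff_lipschitz_at (R : realType) (U W : normedModType R) (f : U -> W)
    (x : U) : differentiable f x ->
  exists2 k : R, 0 < k & \forall y \near x, `|f y - f x| <= k * `|y - x|.
Proof.
move=> df; have [k k0 kd] := linear_lipschitz (diff_continuous df).
exists (k + 1); first exact: addr_gt0.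
have := diff_approx df ltr01; apply: filterS => y h.
rewrite mulrDl -[f y - f x](subrK ('d f x (y - x))) addrC.
by apply: (le_trans (ler_normD _ _)); rewrite lerD.
Qed.

Lemma mx_norm_coord (R : realType) m n (v : 'M[R]_(m, n)) i j : `|v i j| <= `|v|.
Proof.
rewrite [leRHS]/Num.Def.normr /= mx_normrE.
exact: (le_bigmax _ (fun k : 'I_m * 'I_n => `|v k.1 k.2|) (i, j)).
Qed.

Lemma mx_norm_le (R : realType) m n (v : 'M[R]_(m, n)) (c : R) :
  0 <= c -> (forall i j, `|v i j| <= c) -> `|v| <= c.
Proof.
move=> c0 vc; rewrite [leLHS]/Num.Def.normr /= mx_normrE.
by apply: bigmax_le => // -[i j] _; exact: vc.
Qed.

(** The mean value inequality, for a time [T] of either sign. *)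
Lemma is_derive_norm_le (R : realType) n (w w' : R^o -> 'rV[R]_n) (T C : R) :
  (forall s, `|s| <= `|T| -> is_derive (s : R^o) 1 w (w' s)) ->
  (forall s, `|s| <= `|T| -> `|w' s| <= C) ->
  `|w T - w 0| <= `|T| * C.
Proof.
move=> dw wC.
have C0 : 0 <= C by apply: le_trans (wC 0 _); rewrite ?normr0.
apply: mx_norm_le => [|i j]; first by rewrite mulr_ge0.
rewrite !mxE.
have dwi (s : R) : `|s| <= `|T| ->
    is_derive (s : R^o) 1 (fun t : R^o => w t i j : R^o) (w' s i j).
  move=> sT; have [dws <-] := dw s sT; apply: DeriveDef.
    by have /derivable_mxP := dws; exact.
  by rewrite derive_mx // mxE.
have ct (s : R) : `|s| <= `|T| -> {for s, continuous (fun t => w t i j)}.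
  by move=> /dwi [h _]; apply: differentiable_continuous; apply/derivable1_diffP.
have mvt (a b : R) : a <= b -> (forall s, s \in `[a, b] -> `|s| <= `|T|) ->
    `|w b i j - w a i j| <= C * (b - a).
  move=> ab abT.
  have [||c cab ->] := @MVT_segment R (fun t => w t i j) (fun s => w' s i j) a b ab.
  - move=> s sab; apply: dwi; apply: abT.
    by move: sab; rewrite !in_itv /= => /andP [/ltW -> /ltW ->].
  - apply: continuous_in_subspaceT => s; rewrite inE /= => sab.
    by apply: ct; apply: abT.
  rewrite normrM [`|b - a|]ger0_norm ?subr_ge0 // ler_wpM2r ?subr_ge0 //.
  by apply: (le_trans (mx_norm_coord _ _ _)); apply: wC; exact: abT.
have [T0|T0] := leP 0 T.
  rewrite (ger0_norm T0) mulrC -[X in C * X]subr0; apply: mvt => // s.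
  by rewrite in_itv /= => /andP [s0 sT]; rewrite !ger0_norm.
rewrite (ltr0_norm T0) mulrC distrC -[- T]sub0r; apply: mvt => [|s]; first exact: ltW.
rewrite in_itv /= => /andP [s0 sT].
by rewrite (ltr0_norm T0) (ler0_norm sT) lerN2.
Qed.

(** * Linear algebra of row vectors *)

Lemma linear_rV_norm_le (R : realType) n (W : normedModType R)
    (f : {linear 'rV[R]_n -> W}) v :
  `|f v| <= (\sum_i `|f (delta_mx 0 i)|) * `|v|.
Proof.
rewrite [in leLHS](row_sum_delta v) linear_sum mulr_suml.
apply: (le_trans (ler_norm_sum _ _ _)); apply: ler_sum => i _.
by rewrite linearZ normrZ mulrC ler_wpM2l // mx_norm_coord.
Qed.

Lemma linear_rV_bounded (R : realType) n (W : normedModType R)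
    (f : {linear 'rV[R]_n -> W}) :
  exists2 k : R, 0 < k & forall v, `|f v| <= k * `|v|.
Proof.
exists (1 + \sum_i `|f (delta_mx 0 i)|).
  by rewrite ltr_pwDl // sumr_ge0.
move=> v; apply: (le_trans (linear_rV_norm_le f v)).
by rewrite ler_wpM2r // lerDr.
Qed.

Lemma mulmx_bounded (R : realType) n m (A : 'M[R]_(n, m)) :
  exists2 k : R, 0 < k & forall v : 'rV_n, `|v *m A| <= k * `|v|.
Proof.
have [k k0 kA] := linear_rV_bounded (mulmxr A : {linear 'rV_n -> 'rV_m}).
by exists k.
Qed.

(** An inclusion of kernels makes [B] factor through the pair [(A1, A2)], and the
    factor is bounded. *)
Lemma bound_of_kernel (R : realType) n m1 m2 p (A1 : 'M[R]_(n, m1))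
    (A2 : 'M[R]_(n, m2)) (B : 'M[R]_(n, p)) :
  (forall u : 'rV_n, u *m A1 = 0 -> u *m A2 = 0 -> u *m B = 0) ->
  exists2 k : R, 0 < k
    & forall u : 'rV_n, `|u *m B| <= k * (`|u *m A1| + `|u *m A2|).
Proof.
move=> kerAB; pose A := row_mx A1 A2; pose G := pinvmx A *m B.
have uG (u : 'rV_n) : u *m A *m G = u *m B.
  apply/eqP; rewrite eq_sym -subr_eq0 /G.
  have -> : u *m B - u *m A *m (pinvmx A *m B)
      = (u - u *m A *m pinvmx A) *m B by rewrite mulmxBl !mulmxA.
  have : (u - u *m A *m pinvmx A) *m A = 0.
    by rewrite mulmxBl mulmxKpV ?subrr // submxMl.
  rewrite /A mul_mx_row -row_mx0 => /eq_row_mx [u1 u2].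
  by apply/eqP; apply: kerAB.
have [k1 k10 hk1] := mulmx_bounded (usubmx G).
have [k2 k20 hk2] := mulmx_bounded (dsubmx G).
exists (k1 + k2) => [|u]; first exact: addr_gt0.
rewrite -uG -[G]vsubmxK /A mul_mx_row mul_row_col.
apply: (le_trans (ler_normD _ _)); rewrite mulrDr !mulrDl.
apply: (le_trans (lerD (hk1 _) (hk2 _))).
have := mulr_ge0 (ltW k20) (normr_ge0 (u *m A1)).
have := mulr_ge0 (ltW k10) (normr_ge0 (u *m A2)).
lra.
Qed.

Lemma linear_matrix (R : realType) n m (f : 'rV[R]_n -> 'rV[R]_m) :
  linear f -> exists A : 'M[R]_(n, m), forall u, f u = u *m A.
Proof.
move=> lf; pose F : {linear 'rV[R]_n -> 'rV[R]_m} :=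
  HB.pack f (GRing.isLinear.Build _ _ _ _ _ lf).
by exists (lin1_mx F) => u; rewrite mul_rV_lin1.
Qed.

(** Being close to a subspace will be measured by the size of the image by a
    matrix of which it is the kernel. *)
Lemma vspace_kernel (R : realType) n (U : {vspace 'rV[R]_n}) :
  exists Q : 'M[R]_n, forall v, (v *m Q == 0) = (v \in U).
Proof.
have [|Q hQ] := @linear_matrix R n n (fun v => v - projv U v).
  by move=> a u v; rewrite linearP scalerBr opprD addrACA.
exists Q => v; rewrite -hQ subr_eq0; apply/eqP/idP => [->|Uv].
  exact: memv_proj.
by rewrite projv_id.
Qed.

Lemma linear_comb_norm_le (R : realType) n m (u : 'rV[R]_n) (F : 'I_n -> 'rV[R]_m)
    (d : R) : (forall i, `|F i| <= d) ->
  `|\sum_i u 0 i *: F i| <= n%:R * d * `|u|.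
Proof.
move=> Fd; apply: (le_trans (ler_norm_sum _ _ _)).
have -> : n%:R * d * `|u| = \sum_(i < n) `|u| * d.
  by rewrite sumr_const card_ord -[RHS]mulr_natl; ring.
apply: ler_sum => i _; rewrite normrZ ler_pM //.
exact: mx_norm_coord.
Qed.

Lemma is_derive_mulmx (R : realType) n m (A : 'M[R]_(n, m))
    (w : R^o -> 'rV[R]_n) (s : R^o) w' :
  is_derive s 1 w w' -> is_derive s 1 (fun t => w t *m A) (w' *m A).
Proof.
move=> D; pose f : {linear 'rV[R]_n -> 'rV[R]_m} := mulmxr A.
have cf : continuous f.
  have [k k0 kA] := linear_rV_bounded f.
  apply/linear_bounded_continuous/linear_boundedP.
  exists k; split=> [|k' kk' v]; first exact: gtr0_real.
  by apply: (le_trans (kA v)); rewrite ler_wpM2r // ltW.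
have df : differentiable f (w s) by exact: linear_differentiable.
have := is_derive_comp_diff D df.
by rewrite diff_lin.
Qed.

Section CenterSplitting.
Context (K : fieldType) (vT : vectType K).
Implicit Types (A B C D E F : {vspace vT}).

Lemma directv3P A B C : directv (A + B + C)%VS ->
  forall a b c, a \in A -> b \in B -> c \in C -> a + b + c = 0 ->
  [/\ a = 0, b = 0 & c = 0].
Proof.
rewrite directv_addE /= => /and3P [/directv_addP AB _ /eqP ABC] a b c Aa Bb Cc abc.
have c0 : c = 0.
  apply/eqP; rewrite -memv0 -ABC memv_cap Cc andbT.
  by rewrite -memvN; move/eqP: abc; rewrite addr_eq0 => /eqP <-; rewrite memv_add.
move: abc; rewrite c0 addr0 => ab.
have a0 : a = 0.
  apply/eqP; rewrite -memv0 -AB memv_cap Aa.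
  by move/eqP: ab; rewrite addr_eq0 => /eqP ->; rewrite memvN.
by split=> //; rewrite a0 add0r in ab.
Qed.

(** Fullness comes from splitting along [E + F] and then splitting the [F]-part
    along [E' + F']; directness is then a count of dimensions. *)
Lemma center_directv E F E' F' :
  directv (E + F)%VS /\ (E + F)%VS = fullv ->
  directv (E' + F')%VS /\ (E' + F')%VS = fullv ->
  (E <= F')%VS -> (E' <= F)%VS ->
  directv (E + (F :&: F') + E')%VS /\ (E + (F :&: F') + E')%VS = fullv.
Proof.
move=> [/directv_addP EF fEF] [/directv_addP EF' fEF'] sE sE'.
have full : (E + (F :&: F') + E')%VS = fullv.
  apply/eqP; rewrite eqEsubv subvf /=; apply/subvP => v _.
  have : v \in (E + F)%VS by rewrite fEF memvf.
  move=> /memv_addP [e Ee [f Ff ->]].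
  have : f \in (E' + F')%VS by rewrite fEF' memvf.
  move=> /memv_addP [e' Ee' [f' Ff' fE]].
  rewrite fE [e' + f']addrC addrA !memv_add // memv_cap Ff' andbT.
  have -> : f' = f - e' by rewrite fE [e' + f']addrC addrK.
  by rewrite memvB // (subvP sE').
split=> //; apply/directvP => /=; rewrite full.
have dE : (\dim E + \dim F)%N = \dim {: vT} by rewrite -fEF dimv_disjoint_sum.
have dF : (\dim (F :&: F') + \dim E' <= \dim F)%N.
  rewrite -dimv_disjoint_sum.
    by apply: dimvS; rewrite subv_add capvSl.
  apply/eqP; rewrite -subv0 -EF' [(E' :&: F')%VS]capvC.
  by rewrite capvS // capvSr.
apply/eqP; rewrite eqn_leq; apply/andP; split.
  by rewrite -full !(leq_trans (dimv_add_leqif _ _)) // leq_add2r dimv_add_leqif.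
by rewrite -dE -addnA leq_add2l.
Qed.

End CenterSplitting.

(** * Compactness and growth *)

Lemma near_le_of_cvg (R : realType) (T : topologicalType) (f : T -> R) (x : T)
    (y z : R) : f q @[q --> x] --> y -> y < z -> \forall q \near x, f q <= z.
Proof. by move=> fy; exact: (cvgr_le _ fy). Qed.

Lemma compact_locally_bounded (R : realType) (T : topologicalType) (K : set T)
    (f : T -> R) :
  compact K -> (forall x, K x -> exists B, \forall y \near x, f y <= B) ->
  exists B, forall x, K x -> f x <= B.
Proof.
move=> /compact_near_coveringP cK fK.
have cov x : K x -> \forall x' \near x & B \near +oo%R, f x' <= B.
  move=> /fK [B hB]; exists ([set y | f y <= B], [set B' | B <= B']) => /=.
    by split=> //; exact: nbhs_pinfty_ge (num_real B).
  by move=> [y B'] /= [h1 h2]; exact: le_trans h1 h2.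
have [B0 [_ hB]] := cK R (+oo)%R (fun B x => f x <= B) _ cov.
exists (B0 + 1) => x Kx; apply: hB Kx => //; by rewrite ltrDl.
Qed.

(** The covering property of compact sets is applied to the filter of large
    finite sets. *)
Lemma compact_discrete_finite (M : topologicalType) (L S : set M) :
  compact L -> S `<=` L ->
  (forall x, L x -> \forall y \near x, S y -> y = x) -> finite_set S.
Proof.
move=> /compact_near_coveringP cL SL dS.
pose F : set_system (set M) :=
  [set P | exists2 A : set M, finite_set A &
     forall B, finite_set B -> A `<=` B -> P B].
have FF : Filter F.
  split.
  - by exists set0.
  - move=> P Q [A fA hA] [B fB hB]; exists (A `|` B).
      by rewrite finite_setU.
    by move=> C fC ABC; split; [apply: hA|apply: hB] => // z ?; apply: ABC;
      [left|right].
  - by move=> P Q PQ [A fA hA]; exists A => // B fB AB; exact/PQ/hA.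
have cov x : L x -> \forall x' \near x & A \near F, S x' -> A x'.
  move=> Lx; exists ([set y | S y -> y = x], [set A | A x]) => /=.
    split; first exact: dS.
    by exists [set x]; [exact: finite_set1|move=> B _; apply].
  by move=> [y A] /= [yx Ax] Sy; rewrite (yx Sy).
have [A fA hA] := cL (set M) F (fun A x => S x -> A x) FF cov.
have := hA A fA (fun _ => id) => SA.
by apply: sub_finite_set fA => z Sz; apply: (SA z) => //; exact: SL.
Qed.

Lemma expR_unbounded (R : realType) (l A : R) : 0 < l ->
  exists2 t : R, 0 <= t & A <= expR (l * t).
Proof.
move=> l0; exists (`|A| / l); first by rewrite divr_ge0 // ltW.
have -> : l * (`|A| / l) = `|A| by rewrite mulrC divfK // gt_eqF.
apply: (le_trans (ler_norm A)); apply: (le_trans _ (expR_ge1Dx _)).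
by rewrite lerDr.
Qed.

Lemma euclidean_time (R : realType) (T t : R) (J : nat) :
  0 < T -> J%:R * T <= t ->
  exists j r, [/\ t = j%:R * T + r, 0 <= r, r <= T & (J <= j)%N].
Proof.
move=> T0 Jt; have t0 : 0 <= t by apply: le_trans Jt; rewrite mulr_ge0 // ltW.
have tT0 : 0 <= t / T by rewrite divr_ge0 // ltW.
have /andP [h1 h2] := Num.Theory.truncn_itv tT0.
exists (Num.truncn (t / T)), (t - (Num.truncn (t / T))%:R * T); split.
- by rewrite addrC subrK.
- by rewrite subr_ge0 -ler_pdivlMr.
- rewrite lerBlDr -[X in X + _]mul1r -mulrDl -ler_pdivrMr // addrC natr1.
  exact: ltW.
- rewrite -ltnS -(ltr_nat R); apply: le_lt_trans h2.
  by rewrite ler_pdivlMr.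
Qed.

(** * Charts and the tangent flow *)

Section Charts.
Context (R : realType) (n : nat) (M : manifold R n).
Local Notation V := 'rV[R]_n.
Implicit Types (c d e x q : M) (f h : M -> M).

Lemma chart_imgP c x : dom c x -> chart_img c (chart c x).
Proof. by move=> cx; exists x. Qed.

Lemma parmK c y : chart_img c y -> chart c (parm c y) = y.
Proof. by move=> [x cx <-]; rewrite chartK. Qed.

Lemma near_dom c x : dom c x -> \forall q \near x, dom c q.
Proof. by move=> cx; exact: open_nbhs_nbhs (conj (dom_open c) cx). Qed.

Lemma near_chart_img c x : dom c x -> \forall y \near chart c x, chart_img c y.
Proof.
move=> cx; apply: open_nbhs_nbhs; split; first exact: chart_open.
exact: chart_imgP.
Qed.

Lemma chart_cvg c x : dom c x -> chart c q @[q --> x] --> chart c x.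
Proof. by move=> cx; exact: chart_continuous. Qed.

Lemma parm_cvg c x : dom c x -> parm c y @[y --> chart c x] --> x.
Proof.
move=> cx; rewrite -[X in _ --> X](chartK cx).
by apply: parm_continuous; exact: chart_imgP.
Qed.

Lemma near_parm c x (P : set M) : dom c x ->
  (\forall q \near x, P q) -> \forall y \near chart c x, P (parm c y).
Proof. by move=> cx Px; exact: (parm_cvg cx Px). Qed.

Lemma near_chart c x (P : set V) : dom c x ->
  (\forall y \near chart c x, P y) -> \forall q \near x, P (chart c q).
Proof. by move=> cx Px; exact: (chart_cvg cx Px). Qed.

Definition in_charts c d f : V -> V := chart d \o f \o parm c.

(** [differentiable_at] and [diff_at] name a local expression by its map and base
    point on the manifold, rather than by a function on a vector space. The
    differential [diff_at] specializes to [change] (for the identity) and to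
    [tangent_map] (for the charts centred at the point and its image). *)
Definition differentiable_at c d f x : Prop :=
  differentiable (in_charts c d f) (chart c x).

Definition diff_at c d f x : V -> V := 'd (in_charts c d f) (chart c x).

(** The chain rule on a manifold: near [chart c x] the composite of the two local
    expressions is the local expression of the composite. *)
Lemma diff_at_comp c d e f h x v :
  dom c x -> dom d (f x) ->
  {for x, continuous f} ->
  differentiable_at c d f x -> differentiable_at d e h (f x) ->
  differentiable_at c e (h \o f) x /\
  diff_at c e (h \o f) x v = diff_at d e h (f x) (diff_at c d f x v).
Proof.
move=> cx dfx fcont df dh.
have fx : chart d (f x) = in_charts c d f (chart c x).
  by rewrite /in_charts /= chartK.
have fgE : \forall y \near chart c x,
    (in_charts d e h \o in_charts c d f) y = in_charts c e (h \o f) y.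
  have : \forall y \near chart c x, dom d (f (parm c y)).
    by apply: (near_parm cx (P := dom d \o f)); exact/fcont/near_dom.
  by apply: filterS => y dfy; rewrite /in_charts /= chartK.
move: dh; rewrite /diff_at /differentiable_at fx => dh.
have [dhf dE] := diff_near_eq (differentiable_comp df dh) fgE.
split; first exact: dhf.
exact: (etrans (dE v) (diff_comp_app v df dh)).
Qed.

Lemma differentiable_at_id c d x : dom c x -> dom d x ->
  differentiable_at c d id x.
Proof.
move=> cx dx; have [/(_ (chart c x))] := transition_smooth c d 1%N.
by move=> + _; apply; exists x.
Qed.

Lemma changeE c d x : change c d x = diff_at c d id x.
Proof. by []. Qed.

Lemma tangent_mapE f x : tangent_map f x = diff_at x (f x) f x.
Proof. by []. Qed.

Lemma diff_at_id c x v : dom c x -> diff_at c c id x v = v.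
Proof.
move=> cx.
have did : differentiable (@id V) (chart c x) by [].
have [|_ dE] := diff_near_eq (h := in_charts c c id) did.
  by have := near_chart_img cx; apply: filterS => y cy; rewrite /in_charts /= parmK.
by apply: (etrans (dE v)); rewrite diff_val.
Qed.

Lemma changeD c d x u v : change c d x (u + v) = change c d x u + change c d x v.
Proof. exact: linearD. Qed.
Lemma changeZ c d x a v : change c d x (a *: v) = a *: change c d x v.
Proof. exact: linearZ. Qed.
Lemma change0 c d x : change c d x 0 = 0.
Proof. exact: linear0. Qed.

Lemma tangent_mapD f x u v :
  tangent_map f x (u + v) = tangent_map f x u + tangent_map f x v.
Proof. exact: linearD. Qed.
Lemma tangent_mapN f x u : tangent_map f x (- u) = - tangent_map f x u.
Proof. exact: linearN. Qed.
Lemma tangent_mapZ f x a v :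
  tangent_map f x (a *: v) = a *: tangent_map f x v.
Proof. exact: linearZ. Qed.
Lemma tangent_map0 f x : tangent_map f x 0 = 0.
Proof. exact: linear0. Qed.

(* Comparing differentials at different points by unfolding them is very slow. *)
Opaque diff_at differentiable_at change tangent_map.

Lemma change_comp c d e x v : dom c x -> dom d x -> dom e x ->
  change d e x (change c d x v) = change c e x v.
Proof.
move=> cx dx ex; rewrite !changeE; apply/esym.
have [|_ ->//] := @diff_at_comp c d e id id x v cx dx _
  (differentiable_at_id cx dx) (differentiable_at_id dx ex).
exact: cvg_id.
Qed.

Lemma change_id c x v : dom c x -> change c c x v = v.
Proof. by move=> cx; rewrite changeE diff_at_id. Qed.

Lemma changeK c d x v : dom c x -> dom d x -> change d c x (change c d x v) = v.
Proof. by move=> cx dx; rewrite change_comp ?change_id. Qed.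

Section Flow.
Context (X : M -> V) (Xt : R -> M -> M).
Hypothesis XXt : induced_flow X Xt.

(** The flow in charts depends jointly on time and space; this is the function
    that is assumed to be of class C^1. *)
Definition flow_charts c d (p : R^o * V) : V := chart d (Xt p.1 (parm c p.2)).

Lemma flow_charts_diff c d t y : chart_img c y -> dom d (Xt t (parm c y)) ->
  differentiable (flow_charts c d) (t : R^o, y).
Proof.
by move=> cy dy; have [+ _] := flow_C1 XXt c d; apply; split.
Qed.

Lemma flow_charts_diff_continuous c d t y v :
  chart_img c y -> dom d (Xt t (parm c y)) ->
  {for (t : R^o, y), continuous (fun p => 'd (flow_charts c d) p v)}.
Proof.
by move=> cy dy; have [_ /(_ v)] := flow_C1 XXt c d; apply; split.
Qed.

Lemma flow_continuous_at t : continuous (Xt t).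
Proof.
move=> x; apply: (@continuous_comp _ _ _ (fun x => (t, x))
  (fun p : R * M => Xt p.1 p.2)); last exact: flow_continuous XXt _.
exact: (cvg_pair (cvg_cst t) cvg_id).
Qed.

Lemma flow_differentiable_at c d t x v : dom c x -> dom d (Xt t x) ->
  differentiable_at c d (Xt t) x /\
  diff_at c d (Xt t) x v = 'd (flow_charts c d) (t : R^o, chart c x) (0, v).
Proof.
move=> cx dx.
have dF : differentiable (flow_charts c d) (t : R^o, chart c x).
  by apply: flow_charts_diff; rewrite ?chartK //; exact: chart_imgP.
have dcst : differentiable (cst (t : R^o) : V -> R^o) (chart c x) by [].
have did : differentiable (@id V) (chart c x) by [].
have dp := differentiable_pair dcst did.
Transparent differentiable_at diff_at.
split; first exact: (differentiable_comp dp dF).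
have E : 'd (flow_charts c d \o (fun y : V => (cst (t : R^o) y, id y)))
    (chart c x) v = 'd (flow_charts c d) (t : R^o, chart c x) (0, v).
  apply: (etrans (diff_comp_app v dp dF)); congr ('d _ _ _).
  by rewrite (diff_pair dcst did) /= !diff_val.
exact: E.
Qed.
Opaque differentiable_at diff_at.

Lemma tangent_flowD s t x v :
  tangent_map (Xt (s + t)) x v =
  tangent_map (Xt s) (Xt t x) (tangent_map (Xt t) x v).
Proof.
rewrite !tangent_mapE.
have st : Xt (s + t) = Xt s \o Xt t by apply/funext => z; exact: flowD XXt _ _ _.
have dx : dom (Xt (s + t) x) (Xt s (Xt t x)).
  by rewrite -(flowD XXt); exact: dom_self.
have [_] := @diff_at_comp x (Xt t x) (Xt (s + t) x) (Xt t) (Xt s) x v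
  (dom_self x) (dom_self (Xt t x)) (@flow_continuous_at t x)
  (flow_differentiable_at v (dom_self x) (dom_self (Xt t x))).1
  (flow_differentiable_at v (dom_self (Xt t x)) dx).1.
by rewrite -st => ->; rewrite (flowD XXt).
Qed.

Lemma tangent_flow0 x v : tangent_map (Xt 0) x v = v.
Proof.
rewrite tangent_mapE.
have -> : Xt 0 = id by apply/funext => z; exact: flow0 XXt _.
by rewrite diff_at_id //; exact: dom_self.
Qed.

Lemma near_flow_dom d t x : dom d (Xt t x) ->
  \forall s \near (t : R^o), dom d (Xt s x).
Proof.
move=> dx; have : {for t, continuous (fun h : R => Xt h x)}.
  apply: (@continuous_comp _ _ _ (fun h : R => (h, x))
    (fun p : R * M => Xt p.1 p.2)); last exact: flow_continuous XXt _.
  exact: (cvg_pair cvg_id (cvg_cst x)).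
by apply; exact: near_dom.
Qed.

(** The chain rule along a curve on the manifold. *)
Lemma is_derive_diff_at c d f (u : R^o -> M) (t : R^o) x w :
  u t = x -> dom c x -> dom d (f x) -> (\forall s \near t, dom c (u s)) ->
  differentiable_at c d f x ->
  is_derive t 1 (fun s => chart c (u s)) w ->
  is_derive t 1 (fun s => chart d (f (u s))) (diff_at c d f x w).
Proof.
move=> utx cx dx ns df D.
Transparent differentiable_at diff_at.
have df' : differentiable (in_charts c d f) (chart c (u t)).
  by rewrite utx; exact: df.
have := is_derive_comp_diff D df'; rewrite utx => D1.
apply: near_eq_is_derive D1; apply: filterS ns => s cus.
by rewrite /in_charts /= chartK.
Qed.
Opaque differentiable_at diff_at.

(** At time [0] this is the definition of the generator; the group law moves it
    to time [t]. *)
Lemma flow_velocity d t x : dom d (Xt t x) ->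
  is_derive (t : R^o) 1 (fun s : R^o => chart d (Xt s x))
    (change (Xt t x) d (Xt t x) (X (Xt t x))).
Proof.
move=> dx; set q := Xt t x.
have q0 : Xt 0 q = q by exact: flow0 XXt _.
have ns : \forall s \near (0 : R^o), dom q (Xt s q).
  by apply: near_flow_dom; rewrite q0; exact: dom_self.
have := is_derive_diff_at (u := fun s => Xt s q) q0 (dom_self q) dx ns
  (differentiable_at_id (dom_self q) dx) (flow_generator XXt q).
rewrite -changeE => D1.
have D2 : is_derive (t : R^o) 1 (fun s : R^o => s - t : R^o) 1.
  by apply: is_derive_eq; rewrite ?subr0.
have D3 : differentiable (fun h : R^o => chart d (Xt h q)) (t - t : R^o).
  by rewrite subrr; apply/derivable1_diffP; case: D1.
have := is_derive_comp_diff D2 D3.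
rewrite -deriveE // subrr derive_val => D4.
apply: near_eq_is_derive D4; apply: filterE => s /=.
by rewrite /q -(flowD XXt) subrK.
Qed.

(** Both sides are the velocity at time [0] of the curve
    [s |-> Xt t (Xt s x) = Xt s (Xt t x)]. *)
Lemma tangent_flow_field t x : tangent_map (Xt t) x (X x) = X (Xt t x).
Proof.
have q0 y : Xt 0 y = y by exact: flow0 XXt _.
have ns : \forall s \near (0 : R^o), dom x (Xt s x).
  by apply: near_flow_dom; rewrite q0; exact: dom_self.
have [dt _] := flow_differentiable_at 0 (dom_self x) (dom_self (Xt t x)).
have := is_derive_diff_at (u := fun s => Xt s x) (q0 x) (dom_self x)
  (dom_self (Xt t x)) ns dt (flow_generator XXt x).
rewrite -tangent_mapE => D1.
have : is_derive (0 : R^o) 1 (fun s : R^o => chart (Xt t x) (Xt s (Xt t x)))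
   (tangent_map (Xt t) x (X x)).
  apply: near_eq_is_derive D1; apply: filterE => s /=.
  by rewrite -!(flowD XXt) addrC.
case=> _ <-; by case: (flow_generator XXt (Xt t x)).
Qed.

End Flow.
End Charts.

(** * Lengths and areas *)

Section Metric.
Context (R : realType) (n : nat) (M : manifold R n) (g : riemannian_metric M).
Local Notation V := 'rV[R]_n.
Implicit Types (x : M) (u v w : V) (a : R).

Lemma innerDl x u v w : g x (u + v) w = g x u w + g x v w.
Proof. by rewrite -[u]scale1r inner_linear mul1r scale1r. Qed.

Lemma inner0l x w : g x 0 w = 0.
Proof.
have := innerDl x 0 0 w; rewrite addr0 => /esym/eqP.
by rewrite -subr_eq0 addrK => /eqP.
Qed.

Lemma innerZl x a u w : g x (a *: u) w = a * g x u w.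
Proof. by rewrite -[a *: u]addr0 inner_linear inner0l addr0. Qed.

Lemma innerDr x u v w : g x u (v + w) = g x u v + g x u w.
Proof. by rewrite !(inner_sym g x u) innerDl. Qed.

Lemma innerZr x a u w : g x u (a *: w) = a * g x u w.
Proof. by rewrite !(inner_sym g x u) innerZl. Qed.

Lemma inner_ge0 x u : 0 <= g x u u.
Proof.
by have [->|u0] := eqVneq u 0; [rewrite inner0l|exact/ltW/inner_pos].
Qed.

Lemma inner_eq0 x u : g x u u <= 0 -> u = 0.
Proof.
move=> gu; apply/eqP/negP => /negP u0.
by have := inner_pos g x u0; rewrite ltNge gu.
Qed.

(** The Gram determinant of [u] and [v] in terms of the component of [v]
    orthogonal to [u]: the source of the Cauchy-Schwarz inequality and of its
    equality case. *)
Lemma inner_orthogonal_part x u v : u != 0 ->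
  let w := v - (g x u v / g x u u) *: u in
  g x u u * g x w w = g x u u * g x v v - g x u v ^+ 2.
Proof.
move=> u0 w; have gu := inner_pos g x u0.
rewrite /w -scaleNr !(innerDl, innerDr, innerZl, innerZr).
rewrite (inner_sym g x v u); field.
by rewrite gt_eqF.
Qed.

Lemma cauchy_schwarz x u v : g x u v ^+ 2 <= g x u u * g x v v.
Proof.
have [->|u0] := eqVneq u 0; first by rewrite !inner0l expr0n /= mul0r.
rewrite -subr_ge0 -inner_orthogonal_part //.
by rewrite mulr_ge0 // inner_ge0.
Qed.

Lemma area_ge0 x u v : 0 <= area g x u v.
Proof. exact: sqrtr_ge0. Qed.

Lemma area_eq0_line x u v : u != 0 -> area g x u v <= 0 -> v \in <[u]>%VS.
Proof.
move=> u0; rewrite /area => a0.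
have D0 : g x u u * g x v v - g x u v ^+ 2 <= 0.
  by rewrite leNgt -sqrtr_gt0 -leNgt.
have /= wE := inner_orthogonal_part x v u0.
set w := v - _ *: u in wE.
have gu := inner_pos g x u0.
have /inner_eq0/eqP : g x w w <= 0 by rewrite -(pmulr_rle0 _ gu) wE.
rewrite /w subr_eq0 => /eqP ->.
by rewrite memvZ // memv_line.
Qed.

Lemma tnorm_ge0 x u : 0 <= tnorm g x u.
Proof. exact: sqrtr_ge0. Qed.

Lemma tnorm_gt0 x u : u != 0 -> 0 < tnorm g x u.
Proof. by move=> u0; rewrite sqrtr_gt0 inner_pos. Qed.

Lemma tnorm0 x : tnorm g x 0 = 0.
Proof. by rewrite /tnorm inner0l sqrtr0. Qed.

Lemma tnorm_le0 x u : tnorm g x u <= 0 -> u = 0.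
Proof.
move=> u0; apply/eqP/negP => /negP /(tnorm_gt0 x).
by rewrite ltNge u0.
Qed.

Lemma tnormZ x a u : tnorm g x (a *: u) = `|a| * tnorm g x u.
Proof.
by rewrite /tnorm innerZl innerZr mulrA -expr2 sqrtrM ?sqr_ge0 // sqrtr_sqr.
Qed.

Lemma tnormN x u : tnorm g x (- u) = tnorm g x u.
Proof. by rewrite -scaleN1r tnormZ normrN normr1 mul1r. Qed.

Lemma tnormD x u v : tnorm g x (u + v) <= tnorm g x u + tnorm g x v.
Proof.
have s0 := addr_ge0 (tnorm_ge0 x u) (tnorm_ge0 x v).
rewrite -(ger0_norm s0) -sqrtr_sqr /tnorm ler_wsqrtr //.
rewrite !(innerDl, innerDr) sqrrD !sqr_sqrtr ?inner_ge0 //.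
rewrite (inner_sym g x v u) -sqrtrM ?inner_ge0 //.
have : g x u v <= Num.sqrt (g x u u * g x v v).
  by rewrite (le_trans (ler_norm _)) // -sqrtr_sqr ler_wsqrtr // cauchy_schwarz.
move=> ?; lra.
Qed.

Lemma lerB_tnormD x u v : tnorm g x u - tnorm g x v <= tnorm g x (u + v).
Proof.
rewrite lerBlDr -(tnormN x v).
by apply: (le_trans _ (tnormD _ _ _)); rewrite addrK.
Qed.

End Metric.

(** * Consequences of domination and of area growth *)

Section TangentFlow.
Context (R : realType) (n : nat) (M : manifold R n) (g : riemannian_metric M).
Local Notation V := 'rV[R]_n.

Lemma rev_flowK (Xt : R -> M -> M) : rev_flow (rev_flow Xt) = Xt.
Proof. by apply/funext => t; rewrite /rev_flow opprK. Qed.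

(** The properties of a flow and of its tangent flow used by the algebraic
    arguments. They hold for [X] and for [-X] alike, so that each of these
    arguments applies to both splittings. *)
Record tangent_flow (X : M -> V) (Xt : R -> M -> M) : Prop := TangentFlow {
  tflow0 : forall x, Xt 0 x = x;
  tflowD : forall s t x, Xt (s + t) x = Xt s (Xt t x);
  tflow_map0 : forall x v, tangent_map (Xt 0) x v = v;
  tflow_mapD : forall s t x v, tangent_map (Xt (s + t)) x v =
    tangent_map (Xt s) (Xt t x) (tangent_map (Xt t) x v);
  tflow_field : forall t x, tangent_map (Xt t) x (X x) = X (Xt t x)
}.

Lemma tangent_flow_induced X Xt : induced_flow X Xt -> tangent_flow X Xt.
Proof.
move=> XXt; split.
- exact: flow0 XXt.
- exact: flowD XXt.
- exact: tangent_flow0 XXt.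
- exact: tangent_flowD XXt.
- exact: tangent_flow_field XXt.
Qed.

Lemma tangent_flow_rev X Xt :
  tangent_flow X Xt -> tangent_flow (rev_field X) (rev_flow Xt).
Proof.
move=> XXt; split; rewrite /rev_flow /rev_field.
- by move=> x; rewrite oppr0 (tflow0 XXt).
- by move=> s t x; rewrite opprD (tflowD XXt).
- by move=> x v; rewrite oppr0 (tflow_map0 XXt).
- by move=> s t x v; rewrite opprD (tflow_mapD XXt).
- by move=> t x; rewrite tangent_mapN (tflow_field XXt).
Qed.

Section OneFlow.
Context (X : M -> V) (Xt : R -> M -> M) (L : set M).
Hypothesis XXt : tangent_flow X Xt.

Lemma tflowK t x : Xt (- t) (Xt t x) = x.
Proof. by rewrite -(tflowD XXt) addNr (tflow0 XXt). Qed.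

Lemma tflow_mapK t x v :
  tangent_map (Xt (- t)) (Xt t x) (tangent_map (Xt t) x v) = v.
Proof. by rewrite -(tflow_mapD XXt) addNr (tflow_map0 XXt). Qed.

Lemma tflow_mapVK t x v :
  tangent_map (Xt t) (Xt (- t) x) (tangent_map (Xt (- t)) x v) = v.
Proof. by rewrite -(tflow_mapD XXt) addrN (tflow_map0 XXt). Qed.

Lemma compact_invariant_mem t x : compact_invariant Xt L -> L x -> L (Xt t x).
Proof. by move=> [_ iL] Lx; rewrite -(iL t); exists x. Qed.

Lemma compact_invariant_rev :
  compact_invariant Xt L -> compact_invariant (rev_flow Xt) L.
Proof. by move=> [cL iL]; split=> // t; exact: iL. Qed.

Hypothesis invL : compact_invariant Xt L.

Lemma invariant_subbundle_mem E t x v : invariant_subbundle Xt L E ->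
  L x -> v \in E x -> tangent_map (Xt t) x v \in E (Xt t x).
Proof.
move=> [_ /(_ x t)] + Lx Ev => /(_ Lx)/predeqP/(_ (tangent_map (Xt t) x v)) [+ _].
by apply; exists v.
Qed.

(** Pull [e + f] back by time [t]. Contraction makes the pullback of [e] longer
    than any given bound for [t] large, and domination makes the pullback of [f]
    at most half as long as that of [e]. *)
Lemma backward_growth E F x e f B :
  partially_hyperbolic_splitting g Xt L E F ->
  L x -> e \in E x -> f \in F x -> e != 0 ->
  exists2 t : R, 0 <= t
    & B < tnorm g (Xt (- t) x) (tangent_map (Xt (- t)) x (e + f)).
Proof.
move=> [[iE iF _ [K [l [K0 l0 dom]]]] [K' [l' [K'0 l'0 con]]]] Lx Ee Ff e0.
have ne := tnorm_gt0 g x e0; have nf := tnorm_ge0 g x f.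
have nB := normr_ge0 B.
(* [t1] takes care of domination and [t2] of contraction. *)
have [t1 t10 ht1] := expR_unbounded (2 * K * tnorm g x f / tnorm g x e) l0.
have [t2 t20 ht2] := expR_unbounded (K' * (2 * `|B| + 1) / tnorm g x e) l'0.
pose t := t1 + t2; have t0 : 0 <= t by exact: addr_ge0.
exists t => //; rewrite tangent_mapD.
set y := Xt (- t) x; have Ly : L y by exact: compact_invariant_mem.
set et := tangent_map _ x e; set ft := tangent_map _ x f.
have Eet : et \in E y by exact: invariant_subbundle_mem.
have Fft : ft \in F y by exact: invariant_subbundle_mem.
have yx : Xt t y = x by rewrite /y -(tflowD XXt) addrN (tflow0 XXt).
have Det : tangent_map (Xt t) y et = e by exact: tflow_mapVK.
have Dft : tangent_map (Xt t) y ft = f by exact: tflow_mapVK.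
have := dom y t et ft Ly t0 Eet Fft; have := con y et t Ly Eet t0.
rewrite yx Det Dft !mulNr !expRN.
have := lerB_tnormD g y et ft.
have E1 : expR (l * t1) <= expR (l * t) by rewrite ler_expR ler_pM2l // lerDl.
have E2 : expR (l' * t2) <= expR (l' * t) by rewrite ler_expR ler_pM2l // lerDr.
have := le_trans ht1 E1; have := le_trans ht2 E2.
rewrite !ler_pdivrMr //.
have := expR_gt0 (l * t); have := expR_gt0 (l' * t).
have := tnorm_ge0 g y et; have := tnorm_ge0 g y ft.
move: (tnorm g y et) (tnorm g y ft) (tnorm g y (et + ft)) (tnorm g x e) (tnorm g x f)
  (expR (l * t)) (expR (l' * t)) ne nf => a b s p q A A' p0 q0 b0 a0 A'0 A0.
move=> h2 h1 hs h4 h3.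
have h3' : 2 * (p * b) <= p * a.
  have : A * (p * b) <= K * q * a.
    by rewrite mulrC -ler_pdivlMr //; move: h3; congr (_ <= _); field; rewrite gt_eqF.
  have : 2 * K * q * a <= A * p * a by rewrite ler_wpM2r.
  rewrite -(ler_pM2l A0); nra.
have h5 : 2 * b <= a by rewrite -(ler_pM2l p0); nra.
have h6 : p * A' <= K' * a.
  by rewrite -ler_pdivlMr //; move: h4; congr (_ <= _); field; rewrite gt_eqF.
have : 2 * `|B| + 1 <= a.
  by rewrite -(ler_pM2l K'0); apply: (le_trans h2); rewrite mulrC.
have := ler_norm B; nra.
Qed.

(** The backward orbit of a vector of the field consists of vectors of the
    field, which are bounded; so its [E]-part vanishes. *)
Lemma field_mem_center_unstable E F x B :
  partially_hyperbolic_splitting g Xt L E F ->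
  (forall y, tnorm g y (X y) <= B) ->
  L x -> X x \in F x.
Proof.
move=> EF bX Lx; have [[_ _ /(_ x Lx) [_ fullEF] _] _] := EF.
have : X x \in (E x + F x)%VS by rewrite fullEF memvf.
move=> /memv_addP [e Ee [f Ff Xef]].
have [e0|e0] := eqVneq e 0; first by rewrite Xef e0 add0r.
have [t _] := backward_growth B EF Lx Ee Ff e0.
by rewrite -Xef (tflow_field XXt) ltNge bX.
Qed.

Lemma contracting_forward_bounded E x v : contracting g Xt L E ->
  L x -> v \in E x ->
  exists B, forall t, 0 <= t ->
    tnorm g (Xt t x) (tangent_map (Xt t) x v) <= B.
Proof.
move=> [K [l [K0 l0 con]]] Lx Ev; exists (K * tnorm g x v) => t t0.
apply: (le_trans (con x v t Lx Ev t0)).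
rewrite ler_wpM2r ?tnorm_ge0 // ler_piMr //; first exact: ltW.
by rewrite -expR0 ler_expR mulNr oppr_le0 mulr_ge0 // ltW.
Qed.

End OneFlow.

(** A vector of [E] has a bounded future, which is its past under the reversed
    flow; so it has no [E']-part. *)
Lemma stable_sub_center X Xt L E F E' F' x :
  tangent_flow X Xt -> compact_invariant Xt L ->
  partially_hyperbolic_splitting g Xt L E F ->
  partially_hyperbolic_splitting g (rev_flow Xt) L E' F' ->
  L x -> (E x <= F' x)%VS.
Proof.
move=> XXt iL [_ con] EF' Lx; apply/subvP => v Ev.
have [[_ _ /(_ x Lx) [_ fullEF] _] _] := EF'.
have : v \in (E' x + F' x)%VS by rewrite fullEF memvf.
move=> /memv_addP [e Ee [f Ff vef]].
have [e0|e0] := eqVneq e 0; first by rewrite vef e0 add0r.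
have [B bB] := contracting_forward_bounded con Lx Ev.
have [t t0] := backward_growth (tangent_flow_rev XXt) (compact_invariant_rev iL)
  B EF' Lx Ee Ff e0.
by rewrite -vef /rev_flow opprK ltNge bB.
Qed.

(** An area in [F] grows exponentially with time, one in [F'] decreases
    exponentially; in the intersection it must be zero. *)
Lemma area_center_eq0 X Xt L F F' x u v :
  tangent_flow X Xt -> compact_invariant Xt L ->
  invariant_subbundle Xt L F -> sectionally_expanding g Xt L F ->
  invariant_subbundle (rev_flow Xt) L F' ->
  sectionally_expanding g (rev_flow Xt) L F' ->
  L x -> u \in (F x :&: F' x)%VS -> v \in (F x :&: F' x)%VS ->
  area g x u v <= 0.
Proof.
move=> XXt iL iF [K [l [K0 l0 ex]]] iF' [K' [l' [K'0 l'0 ex']]] Lx.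
rewrite !memv_cap => /andP [Fu F'u] /andP [Fv F'v].
have [t t0 ht] := expR_unbounded (2 * K * K') l0.
have Ly : L (Xt t x) by exact: (compact_invariant_mem t iL Lx).
have F'D w : w \in F' x -> tangent_map (Xt t) x w \in F' (Xt t x).
  move=> F'w; have := invariant_subbundle_mem (- t) iF' Lx F'w.
  by rewrite /rev_flow opprK.
have := ex' _ t _ _ Ly t0 (F'D _ F'u) (F'D _ F'v).
rewrite /rev_flow !(tflow_mapK XXt) (tflowK XXt).
have := ex _ t _ _ Lx t0 Fu Fv.
have e1 : 1 <= expR (l' * t) by rewrite -expR0 ler_expR mulr_ge0 // ltW.
have := area_ge0 g x u v.
have := area_ge0 g (Xt t x) (tangent_map (Xt t) x u) (tangent_map (Xt t) x v).
move: (area g x u v) (area g (Xt t x) _ _) (expR (l * t)) (expR (l' * t)) ht e1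
  => a b A A' hA hA' b0 a0.
rewrite -!mulrA !ler_pdivrMl // => h1 h2.
have h3 : b <= A' * b by rewrite ler_peMl.
have h4 : 2 * K * K' * a <= A * a by rewrite ler_wpM2r.
have h5 : K * b <= K * (K' * a) by rewrite ler_pM2l // (le_trans h3).
rewrite -(pmulr_rle0 _ (mulr_gt0 K0 K'0)); nra.
Qed.

End TangentFlow.

(** * The vector field and the flow in charts *)

Section LocalField.
Context (R : realType) (n : nat) (M : manifold R n).
Local Notation V := 'rV[R]_n.
Context (X : M -> V).
Hypothesis C1X : C1_vector_field X.

Definition field_in c q : V := change q c q (X q).

Lemma field_in_parm_diff c x : dom c x ->
  differentiable (fun y => field_in c (parm c y)) (chart c x).
Proof. by move=> cx; have [+ _] := C1X c; apply; exact: chart_imgP. Qed.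

Lemma field_in_continuous c x : dom c x ->
  field_in c q @[q --> x] --> field_in c x.
Proof.
move=> cx.
have ct : {for chart c x, continuous (fun y => field_in c (parm c y))}.
  exact/differentiable_continuous/field_in_parm_diff.
have := cvg_comp _ _ (chart_cvg cx) ct; rewrite /= chartK //.
apply: cvg_trans; apply: near_eq_cvg.
by have := near_dom cx; apply: filterS => q cq /=; rewrite chartK.
Qed.

Lemma field_in_singular c x : X x = 0 -> field_in c x = 0.
Proof. by rewrite /field_in => ->; rewrite change0. Qed.

Lemma field_in_lipschitz c x : dom c x -> X x = 0 ->
  exists2 k : R, 0 < k
    & \forall q \near x, `|field_in c q| <= k * `|chart c q - chart c x|.
Proof.
move=> cx Xx; have [k k0 kd] := diff_lipschitz_at (field_in_parm_diff cx).
exists k => //; have := near_chart cx kd; apply: filterS2 (near_dom cx) => q cq.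
by rewrite !chartK // (field_in_singular c Xx) subr0.
Qed.

Lemma regular_near x : X x != 0 -> \forall q \near x, X q != 0.
Proof.
move=> Xx; have fx0 : field_in x x != 0.
  by rewrite /field_in (change_id _ (dom_self x)).
have ct := field_in_continuous (dom_self x).
have nz : \forall q \near x, field_in x q != 0 by exact: cvgr_neq0 _ ct fx0.
apply: filterS nz => q /=; apply: contra_neq => Xq; exact: field_in_singular.
Qed.

Section Bounded.
Variable g : riemannian_metric M.

Lemma tnorm_sum (I : Type) (r : seq I) x (F : I -> V) :
  tnorm g x (\sum_(i <- r) F i) <= \sum_(i <- r) tnorm g x (F i).
Proof.
apply: (big_ind2 (fun u b => tnorm g x u <= b)) => //; first by rewrite tnorm0.
by move=> u a v b ua vb; apply: (le_trans (tnormD _ _ _ _)); rewrite lerD.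
Qed.

Lemma tnorm_change_continuous c v :
  tnorm g q (change c q q v) @[q --> c] --> tnorm g c (change c c c v).
Proof.
have cc := dom_self c.
have ct : {for chart c c, continuous (fun y => let x := parm c y in
    g x (change c x x v) (change c x x v) : R^o)}.
  exact: (inner_smooth g c v v 0%N _ (chart_imgP cc)).
have := cvg_comp _ _ (chart_cvg cc) ct; rewrite /= chartK // => ct'.
have : g q (change c q q v) (change c q q v) @[q --> c] -->
    g c (change c c c v) (change c c c v).
  apply: cvg_trans ct'; apply: near_eq_cvg.
  by have := near_dom cc; apply: filterS => q cq /=; rewrite chartK.
by move=> /cvg_comp; apply; exact: sqrt_continuous.
Qed.

(** In the coordinates of the chart [c], the field is continuous and the metric
    has continuous coefficients. *)
Lemma field_locally_bounded (c : M) :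
  exists B, \forall q \near c, tnorm g q (X q) <= B.
Proof.
have cc := dom_self c.
pose a (i : 'I_n) := tnorm g c (change c c c (delta_mx 0 i)) + 1.
exists (\sum_i (`|field_in c c| + 1) * a i).
have h1 : \forall q \near c, `|field_in c q| <= `|field_in c c| + 1.
  have ct : `|field_in c q| @[q --> c] --> `|field_in c c|.
    exact: cvg_norm (field_in_continuous cc).
  by apply: near_le_of_cvg ct _; rewrite ltrDl.
have h2 : \forall q \near c, forall i,
    tnorm g q (change c q q (delta_mx 0 i)) <= a i.
  apply: filter_forall => i.
  have ct := tnorm_change_continuous (c := c) (v := delta_mx 0 i).
  have lt1 : tnorm g c (change c c c (delta_mx 0 i)) < a i by rewrite ltrDl.
  exact: near_le_of_cvg ct lt1.
apply: filterS3 (near_dom cc) h1 h2 => q cq q1 q2.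
have -> : X q = \sum_i field_in c q 0 i *: change c q q (delta_mx 0 i).
  rewrite -[LHS](changeK _ (dom_self q) cq) -/(field_in c q).
  rewrite [in LHS](row_sum_delta (field_in c q)).
  have : forall (r : seq 'I_n), change c q q (\sum_(i <- r)
      field_in c q 0 i *: delta_mx 0 i) =
      \sum_(i <- r) field_in c q 0 i *: change c q q (delta_mx 0 i).
    elim=> [|i r IH]; first by rewrite !big_nil change0.
    by rewrite !big_cons changeD changeZ IH.
  exact.
apply: (le_trans (tnorm_sum _ _ _)); apply: ler_sum => i _.
rewrite tnormZ ler_pM ?tnorm_ge0 //.
exact: (le_trans (mx_norm_coord _ _ _)).
Qed.

Lemma field_bounded : compact [set: M] ->
  exists B, forall x, tnorm g x (X x) <= B.
Proof.
move=> /compact_locally_bounded /(_ (fun x _ => field_locally_bounded x)).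
by move=> [B hB]; exists B => x; exact: hB.
Qed.

End Bounded.
End LocalField.

Section FlowCharts.
Context (R : realType) (n : nat) (M : manifold R n).
Local Notation V := 'rV[R]_n.

Lemma diff_at_change c d (f : M -> M) x v : dom c x -> dom d (f x) ->
  {for x, continuous f} ->
  differentiable_at c d f x -> differentiable_at x (f x) f x ->
  diff_at c d f x (change x c x v) = change (f x) d (f x) (tangent_map f x v).
Proof.
move=> cx dfx cf df1 df2; have xx := dom_self x; have fxx := dom_self (f x).
have [_ e1] := @diff_at_comp _ _ _ x c d id f x v xx cx cvg_id
  (differentiable_at_id xx cx) df1.
have [_ e2] := @diff_at_comp _ _ _ x (f x) d f id x v xx fxx cf
  df2 (differentiable_at_id fxx dfx).
by rewrite !changeE tangent_mapE -e1 -e2.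
Qed.

Context (X : M -> V) (Xt : R -> M -> M).
Hypothesis XXt : induced_flow X Xt.

(** Invariance of the field under the tangent flow, read in one chart. *)
Lemma field_in_flow c t x : dom c x -> dom c (Xt t x) ->
  field_in X c (Xt t x) = 'd (flow_charts Xt c c) (t : R^o, chart c x)
    (0, field_in X c x).
Proof.
move=> cx ctx.
have [d1 <-] := flow_differentiable_at XXt (field_in X c x) cx ctx.
have [d2 _] := flow_differentiable_at XXt 0 (dom_self x) (dom_self (Xt t x)).
have ct := @flow_continuous_at _ _ _ _ _ XXt t x.
by rewrite /field_in (diff_at_change _ cx ctx ct d1 d2) (tangent_flow_field XXt).
Qed.

(** Continuity of the flow at all times of a compact interval, made uniform by
    compactness of the interval. *)
Lemma flow_stays_near x (T : R) (W : set M) : (forall t, Xt t x = x) ->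
  nbhs x W -> \forall q \near x, forall s, `|s| <= T -> W (Xt s q).
Proof.
move=> fix_x xW.
have /compact_near_coveringP cT := @segment_compact R (- T) T.
have cov (s : R) : [set` `[- T, T]] s ->
    \forall s' \near s & q \near x, W (Xt s' q).
  move=> _; have ct : Xt p.1 p.2 @[p --> (s, x)] --> Xt s x.
    exact: (@flow_continuous _ _ _ _ _ XXt (s, x)).
  by rewrite fix_x in ct; exact: (ct W xW).
have := cT M (nbhs x) (fun q s => W (Xt s q)) (nbhs_filter x) cov.
by apply: filterS => q h s sT; apply: h; rewrite /= in_itv /= -ler_norml.
Qed.

(** The speed along an orbit is obtained from the initial speed by the
    differential of the flow, which is bounded near [(s, x)] by continuity, hence
    uniformly over a compact interval of times. *)
Lemma flow_field_bound x (T : R) : (forall t, Xt t x = x) ->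
  exists2 B : R, 0 < B & \forall q \near x, forall s, `|s| <= T ->
    dom x (Xt s q) -> `|field_in X x (Xt s q)| <= B * `|field_in X x q|.
Proof.
move=> fix_x; have xx := dom_self x.
have /compact_near_coveringP cT := @segment_compact R (- T) T.
(* [b s y] bounds the norm of the differential in space of the flow. *)
pose b (s : R^o) (y : V) : R :=
  \sum_i `|'d (flow_charts Xt x x) (s, y) (0 : R^o, delta_mx 0 i : V)|.
have cov (s : R) : [set` `[- T, T]] s ->
    \forall s' \near s & i \near filter_prod (pinfty_nbhs R) (nbhs x),
      b s' (chart x i.2) <= i.1.
  move=> _.
  have ctb : b p.1 p.2 @[p --> (s, chart x x)] --> b s (chart x x).
    apply: cvg_big => [|i _]; first exact: add_continuous.
    apply: cvg_norm.
    have img : chart_img x (chart x x) by exact: chart_imgP.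
    have fdom : dom x (Xt s (parm x (chart x x))) by rewrite chartK // fix_x.
    have ct := @flow_charts_diff_continuous _ _ _ _ _ XXt x x s _
      (0 : R^o, delta_mx 0 i) img fdom.
    by apply: cvg_trans ct; apply: near_eq_cvg; apply: filterE => -[].
  have : \forall p \near (s, chart x x), b p.1 p.2 <= b s (chart x x) + 1.
    by apply: near_le_of_cvg ctb _; rewrite ltrDl.
  move=> [[U1 U2] /= [sU1 yU2] hU].
  exists (U1, [set i | U2 (chart x i.2) /\ b s (chart x x) + 1 <= i.1]) => /=.
    split=> //; exists ([set B | b s (chart x x) + 1 <= B],
      [set q | U2 (chart x q)]) => /=.
      split; first exact: nbhs_pinfty_ge (num_real _).
      exact: near_chart.
    by move=> [B q] /= [].
  move=> [s' [B q]] /= [s'U1 [qU2]]; apply: le_trans.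
  by have := hU (s', chart x q); apply.
have FF : Filter (filter_prod (pinfty_nbhs R) (nbhs x)).
  exact: filter_prod_filter.
have := cT (R * M)%type (filter_prod (pinfty_nbhs R) (nbhs x))
  (fun i s => b s (chart x i.2) <= i.1) FF cov.
move=> [[U1 U2] /= [[B0 [_ hB0]] xU2] hU].
exists (`|B0| + 1); first by rewrite ltr_wpDl.
apply: filterS2 (near_dom xx) xU2 => q xq qU2 s sT xsq.
rewrite (field_in_flow xq xsq).
have hlin : linear (fun v : V =>
    'd (flow_charts Xt x x) (s : R^o, chart x q) (0 : R^o, v)).
  move=> a u v; rewrite -linearP; congr ('d _ _ _).
  by apply/pair_equal_spec; split=> //=; rewrite scaler0 addr0.
pose f : {linear V -> V} := HB.pack (fun v : V =>
    'd (flow_charts Xt x x) (s : R^o, chart x q) (0 : R^o, v))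
  (GRing.isLinear.Build _ _ _ _ _ hlin).
apply: (le_trans (linear_rV_norm_le f _)).
rewrite ler_wpM2r //.
have := hU (`|B0| + 1, q); apply.
  split=> //=; apply: hB0; apply: (le_lt_trans (ler_norm _)); by rewrite ltrDl.
by rewrite /= in_itv /= -ler_norml.
Qed.

End FlowCharts.

(** * Contraction near a singularity *)

Section LocalContraction.
Context (R : realType) (n : nat) (M : manifold R n).
Local Notation V := 'rV[R]_n.

Lemma change_sum (c d x : M) k (a : 'I_k -> R) (F : 'I_k -> V) :
  change c d x (\sum_i a i *: F i) = \sum_i a i *: change c d x (F i).
Proof.
elim: (index_enum _) => [|i r IH]; first by rewrite !big_nil change0.
by rewrite !big_cons changeD changeZ IH.
Qed.

(** Continuity of a subbundle at [p]: vectors of nearby fibres make a small angle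
    with the fibre at [p]. A nearby vector is a combination of the frame whose
    coefficients are controlled by its length, because the frame at [p] is free;
    replacing the frame by its value at [p], which [Q] kills, changes it
    little. *)
Lemma subbundle_cone L (E : M -> {vspace V}) (p : M) m (Q : 'M[R]_(n, m))
    (e : R) :
  subbundle L E -> L p -> (forall v, v \in E p -> v *m Q = 0) -> 0 < e ->
  \forall q \near p, L q -> forall w, w \in E q ->
    `|change q p q w *m Q| <= e * `|change q p q w|.
Proof.
move=> sE Lp EQ e0; have [U [k [b [oU Up Udom bE cb]]]] := sE p Lp.
pose f j q := change q p q (tnth (b q) j).
have fp j : f j p = tnth (b p) j by rewrite /f (change_id _ (dom_self p)).
pose B := \matrix_(j < k) f j p.
have aB (a : 'rV_k) : a *m B = \sum_j a 0 j *: f j p.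
  by rewrite mulmx_sum_row; apply: eq_bigr => j _; rewrite rowK.
have freeb : free (b p) by exact: basis_free (bE p Lp Up).
have kerB (a : 'rV_k) : a *m B = 0 -> a *m (0 : 'M[R]_(k, 0)) = 0 -> a *m 1%:M = 0.
  rewrite mulmx1 aB => a0 _; apply/rowP => j; rewrite mxE.
  move/freeP : freeb; apply.
  rewrite -[RHS]a0; apply: eq_bigr => i _.
  by rewrite fp (tnth_nth 0).
have [C C0 hC] := bound_of_kernel kerB.
have [K K0 hK] := mulmx_bounded Q.
have k1 : 0 < k%:R + 1 :> R by rewrite ltr_wpDl.
(* The first bound keeps the coefficients under control, the second one makes
   the angle at most [e]. *)
pose d := Num.min (2 * C * (k%:R + 1))^-1 (e / (2 * C * K * (k%:R + 1))).
have d0 : 0 < d.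
  by rewrite lt_min invr_gt0 divr_gt0 ?mulr_gt0.
have near_f : \forall q \near p, L q -> forall j, `|f j q - f j p| <= d.
  have : \forall q \near p, forall j : 'I_k, L q -> U q -> `|f j q - f j p| <= d.
    apply: filter_forall => j.
    have /subspace_continuousP/(_ p (conj Lp Up)) := cb j.
    move=> /cvgrPdist_le/(_ d d0); rewrite near_withinE.
    by apply: filterS => q h Lq Uq; rewrite distrC; apply: h.
  have Un : \forall q \near p, U q by exact: open_nbhs_nbhs.
  by apply: filterS2 Un => q Uq h Lq j; exact: h.
have Un : \forall q \near p, U q by exact: open_nbhs_nbhs.
apply: filterS2 near_f Un => q /[swap] Uq + Lq w Ew => /(_ Lq) hf.
pose a : 'rV_k := \row_j coord (b q) j w.
have wE : change q p q w = \sum_j a 0 j *: f j q.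
  rewrite {1}(coord_basis (bE q Lq Uq) Ew) change_sum.
  by apply: eq_bigr => j _; rewrite mxE /f (tnth_nth 0).
have split_w : change q p q w = a *m B + \sum_j a 0 j *: (f j q - f j p).
  by rewrite wE aB -big_split /=; apply: eq_bigr => j _; rewrite -scalerDr subrKC.
set r := \sum_j _ in split_w.
have rle : `|r| <= (k%:R + 1) * d * `|a|.
  apply: (le_trans (linear_comb_norm_le _ hf)).
  by rewrite ler_wpM2r // ler_wpM2r ?lerDl //; exact: ltW.
have aBQ : a *m B *m Q = 0.
  rewrite aB mulmx_suml big1 // => j _; rewrite -scalemxAl fp EQ ?scaler0 //.
  by rewrite -(span_basis (bE p Lp Up)) memv_span // mem_tnth.
have a_le : `|a| <= C * `|a *m B|.
  by have := hC a; rewrite mulmx1 mulmx0 normr0 addr0.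
have d1 : (k%:R + 1) * d * C <= 1 / 2.
  have h : d * (C * (k%:R + 1)) <= (2 * C * (k%:R + 1))^-1 * (C * (k%:R + 1)).
    by rewrite ler_pM2r ?mulr_gt0 // ge_min lexx.
  have -> : (k%:R + 1) * d * C = d * (C * (k%:R + 1)) by ring.
  apply: (le_trans h); rewrite le_eqVlt; apply/orP; left; apply/eqP; field.
  by rewrite !gt_eqF.
have d2 : 2 * C * K * (k%:R + 1) * d <= e.
  have : d <= e / (2 * C * K * (k%:R + 1)) by rewrite ge_min lexx orbT.
  by rewrite ler_pdivlMr ?mulr_gt0 // mulrC.
have r1 : C * `|r| <= 1 / 2 * `|a|.
  have : C * `|r| <= C * ((k%:R + 1) * d * `|a|) by rewrite ler_pM2l.
  have : (k%:R + 1) * d * C * `|a| <= 1 / 2 * `|a| by rewrite ler_wpM2r.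
  nra.
have aw : `|a| <= 2 * C * `|change q p q w|.
  have : `|a *m B| <= `|change q p q w| + `|r|.
    rewrite split_w -{1}[a *m B](addrK r).
    by apply: (le_trans (ler_normB _ _)).
  rewrite -(ler_pM2l C0); nra.
have -> : change q p q w *m Q = r *m Q by rewrite split_w mulmxDl aBQ add0r.
apply: (le_trans (hK _)).
have h1 : K * `|r| <= K * ((k%:R + 1) * d * `|a|) by rewrite ler_pM2l.
have Kd0 : 0 <= K * ((k%:R + 1) * d) by rewrite !mulr_ge0 // ltW.
have h2 : K * ((k%:R + 1) * d) * `|a| <=
    K * ((k%:R + 1) * d) * (2 * C * `|change q p q w|) by rewrite ler_wpM2l.
have h3 : 2 * C * K * (k%:R + 1) * d * `|change q p q w| <=
  e * `|change q p q w| by rewrite ler_wpM2r.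
nra.
Qed.

Lemma differentiable_at_approx c d (f : M -> M) x (e : R) :
  dom c x -> differentiable_at c d f x -> 0 < e ->
  \forall q \near x, `|chart d (f q) - chart d (f x)
    - diff_at c d f x (chart c q - chart c x)| <= e * `|chart c q - chart c x|.
Proof.
Transparent differentiable_at diff_at.
move=> cx df e0; have := near_chart cx (diff_approx df e0).
apply: filterS2 (near_dom cx) => q cq.
by rewrite /in_charts /= !chartK.
Qed.
Opaque differentiable_at diff_at.

Context (X : M -> V) (Xt : R -> M -> M) (L : set M).
Hypotheses (C1X : C1_vector_field X) (XXt : induced_flow X Xt).

(** Write [u] for [q - p] in the chart of [p]. The displacement of [q] in time
    [T] almost lies in [C p], because the velocity does all along the orbit
    ([subbundle_cone] for [F] and for [F']); and it is [DX_T u - u] up to a small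
    multiple of the length of [u]. By [bound_of_kernel] and the injectivity of
    [DX_T - 1] modulo [C p], the part of [u] off [C p] is small compared with
    [u], and on the part in [C p] the map [DX_T] contracts by one half. *)
Lemma local_contraction (F F' : M -> {vspace V}) (p : M) (T : R) :
  subbundle L F -> subbundle L F' -> (forall t q, L q -> L (Xt t q)) ->
  (forall q, L q -> X q \in F q /\ X q \in F' q) ->
  L p -> (forall t, Xt t p = p) -> X p = 0 ->
  (forall u, tangent_map (Xt T) p u - u \in (F p :&: F' p)%VS ->
     u \in (F p :&: F' p)%VS) ->
  (forall u, u \in (F p :&: F' p)%VS ->
     `|tangent_map (Xt T) p u| <= 1 / 2 * `|u|) ->
  \forall q \near p, L q ->
    `|chart p (Xt T q) - chart p p| <= 3 / 4 * `|chart p q - chart p p|.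
Proof.
move=> sF sF' iL XF Lp fix_p Xp injC contrC; have pp := dom_self p.
have [Dm hD] : exists A : 'M[R]_n, forall u, tangent_map (Xt T) p u = u *m A.
  by apply: linear_matrix => a u v; rewrite tangent_mapD tangent_mapZ.
have [Q1 hQ1] := vspace_kernel (F p); have [Q2 hQ2] := vspace_kernel (F' p).
pose C := (F p :&: F' p)%VS.
have [QC hQC] : exists A : 'M[R]_n, forall u, u - projv C u = u *m A.
  by apply: linear_matrix => a u v; rewrite linearP scalerBr opprD addrACA.
pose P := Dm - 1%:M.
have [|k k0 hk] := @bound_of_kernel R n n n n (P *m Q1) (P *m Q2) QC.
  move=> u; rewrite !mulmxA => /eqP + /eqP; rewrite hQ1 hQ2 => F1 F2.
  rewrite -hQC; apply/eqP; rewrite subr_eq0 eq_sym; apply/eqP/projv_id.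
  by apply: injC; rewrite memv_cap hD -[X in _ - X]mulmx1 -mulmxBr F1 F2.
have [d d0 hd] := mulmx_bounded Dm.
have [q1 q10 hq1] := mulmx_bounded Q1; have [q2 q20 hq2] := mulmx_bounded Q2.
have [l l0 near_l] := field_in_lipschitz C1X pp Xp.
have [B B0 near_B] := flow_field_bound XXt `|T| fix_p.
(* [eta] bounds the relative size of the part of [u] off [C p]; one eighth is
   spent on it and one eighth on the remainder of order one, so that the factor
   one half of [contrC] becomes three quarters. *)
have [eta eta0 etaE] : exists2 eta, 0 < eta & eta * (1 / 2 + d) = 1 / 8.
  have h0 : 0 < 1 / 2 + d by rewrite addr_gt0.
  by exists (1 / 8 / (1 / 2 + d)); rewrite ?divr_gt0 // divfK // gt_eqF.
have [e e0 eE] : exists2 e,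
    0 < e & e * ((`|T| + 1) * B * l) = eta / (4 * k).
  have h0 : 0 < (`|T| + 1) * B * l by rewrite !mulr_gt0 // ltr_wpDl.
  by exists (eta / (4 * k) / ((`|T| + 1) * B * l));
     rewrite ?divr_gt0 ?mulr_gt0 // divfK // gt_eqF.
have [de de0 deE] : exists2 de, 0 < de & de * (q1 + q2) = eta / (2 * k).
  have h0 : 0 < q1 + q2 by rewrite addr_gt0.
  by exists (eta / (2 * k) / (q1 + q2));
     rewrite ?divr_gt0 ?mulr_gt0 // divfK // gt_eqF.
have pTp : dom p (Xt T p) by rewrite fix_p.
have dT := (flow_differentiable_at XXt 0 pp pTp).1.
have TE u : diff_at p p (Xt T) p u = u *m Dm by rewrite -hD tangent_mapE fix_p.
have near_d1 := differentiable_at_approx pp dT (divr_gt0 ltr01 (ltr0n R 8)).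
have near_d2 := differentiable_at_approx pp dT de0.
have QF1 v : v \in F p -> v *m Q1 = 0 by rewrite -hQ1 => /eqP.
have QF2 v : v \in F' p -> v *m Q2 = 0 by rewrite -hQ2 => /eqP.
have cone1 := subbundle_cone sF Lp QF1 e0.
have cone2 := subbundle_cone sF' Lp QF2 e0.
pose W : set M := [set q | dom p q /\ (L q ->
  `|field_in X p q *m Q1| <= e * `|field_in X p q| /\
  `|field_in X p q *m Q2| <= e * `|field_in X p q|)].
have pW : nbhs p W.
  apply: filterS3 (near_dom pp) cone1 cone2 => q pq c1 c2; split=> // Lq.
  by have [Fq F'q] := XF q Lq; split; [exact: c1|exact: c2].
have near_W := flow_stays_near XXt `|T| fix_p pW.
move: near_l; apply: filter_app; move: near_B; apply: filter_app.
move: near_W; apply: filter_app; move: near_d1; apply: filter_app.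
move: near_d2; apply: filter_app.
apply: filterE => q qd2 qd1 qW qB ql Lq.
move: qd1 qd2; rewrite fix_p !TE.
set u := chart p q - chart p p; set r := _ - _ - _ => qd1 qd2.
have qp : dom p q.
  by have [] := qW 0; rewrite ?normr0 // (flow0 XXt).
have disp m (Q : 'M[R]_(n, m)) : (forall s, `|s| <= `|T| ->
      `|field_in X p (Xt s q) *m Q| <= e * `|field_in X p (Xt s q)|) ->
    `|(chart p (Xt T q) - chart p q) *m Q| <= `|T| * (e * (B * (l * `|u|))).
  move=> sQ; rewrite mulmxBl -[in X in _ - X](flow0 XXt q).
  apply: (is_derive_norm_le (w := fun s => chart p (Xt s q) *m Q)
      (w' := fun s => field_in X p (Xt s q) *m Q)) => s sT.
    by apply: is_derive_mulmx; apply: (flow_velocity XXt); have [] := qW s sT.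
  apply: (le_trans (sQ s sT)); rewrite ler_pM2l //.
  have [sp _] := qW s sT; apply: (le_trans (qB s sT sp)).
  by rewrite ler_pM2l.
have disp1 : `|(chart p (Xt T q) - chart p q) *m Q1| <=
    `|T| * (e * (B * (l * `|u|))).
  by apply: disp => s sT; have [_ /(_ (iL s q Lq)) []] := qW s sT.
have disp2 : `|(chart p (Xt T q) - chart p q) *m Q2| <=
    `|T| * (e * (B * (l * `|u|))).
  by apply: disp => s sT; have [_ /(_ (iL s q Lq)) []] := qW s sT.
have uP : u *m P = (chart p (Xt T q) - chart p q) - r.
  rewrite /P mulmxBr mulmx1 /r; move: (u *m Dm) => v; rewrite /u.
  by apply/rowP => i; rewrite !mxE; ring.
have cube : `|T| * (e * (B * (l * `|u|))) <= eta / (4 * k) * `|u|.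
  have -> : eta / (4 * k) * `|u| = (`|T| + 1) * (e * (B * (l * `|u|))).
    by rewrite -eE; ring.
  by rewrite ler_wpM2r ?lerDl // !mulr_ge0 // ltW.
have uQC : `|u *m QC| <= eta * `|u|.
  apply: (le_trans (hk u)); rewrite !mulmxA uP.
  have t1 : `|(chart p (Xt T q) - chart p q - r) *m Q1| <=
      eta / (4 * k) * `|u| + q1 * (de * `|u|).
    rewrite mulmxBl; apply: (le_trans (ler_normB _ _)).
    apply: lerD; first exact: le_trans disp1 cube.
    by apply: (le_trans (hq1 _)); rewrite ler_pM2l.
  have t2 : `|(chart p (Xt T q) - chart p q - r) *m Q2| <=
      eta / (4 * k) * `|u| + q2 * (de * `|u|).
    rewrite mulmxBl; apply: (le_trans (ler_normB _ _)).
    apply: lerD; first exact: le_trans disp2 cube.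
    by apply: (le_trans (hq2 _)); rewrite ler_pM2l.
  have etaE' : eta = k * (eta / (4 * k) + eta / (4 * k) + de * (q1 + q2)).
    by rewrite deE; field; rewrite gt_eqF.
  have -> : eta * `|u| = k * ((eta / (4 * k) * `|u| + q1 * (de * `|u|)) +
     (eta / (4 * k) * `|u| + q2 * (de * `|u|))) by rewrite {1}etaE'; ring.
  by rewrite ler_pM2l // lerD.
have cC : projv C u \in C by exact: memv_proj.
have uE : u = projv C u + u *m QC by rewrite -hQC addrC subrK.
have cle : `|projv C u| <= (1 + eta) * `|u|.
  have -> : projv C u = u - u *m QC by rewrite {2}uE addrK.
  by apply: (le_trans (ler_normB _ _)); rewrite mulrDl mul1r lerD2l.
have DuE : u *m Dm = tangent_map (Xt T) p (projv C u) + u *m QC *m Dm.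
  by rewrite hD -mulmxDl -uE.
have Du : `|u *m Dm| <= 1 / 2 * ((1 + eta) * `|u|) + d * (eta * `|u|).
  rewrite DuE; apply: (le_trans (ler_normD _ _)); apply: lerD.
    by apply: (le_trans (contrC _ cC)); rewrite ler_pM2l.
  by apply: (le_trans (hd _)); rewrite ler_pM2l.
have -> : chart p (Xt T q) - chart p p = u *m Dm + r by rewrite /r [RHS]addrC subrK.
apply: (le_trans (ler_normD _ _)); apply: (le_trans (lerD Du qd1)).
have -> : 3 / 4 * `|u| = (1 / 2 + eta * (1 / 2 + d) + 1 / 8) * `|u|.
  by rewrite etaE; congr (_ * _); field.
by rewrite le_eqVlt; apply/orP; left; apply/eqP; field.
Qed.

End LocalContraction.

(** * Traps and limit sets *)

Section Traps.
Context (R : realType) (M : topologicalType).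
Hypothesis hM : hausdorff_space M.
Implicit Types (Xt : R -> M -> M) (L U W : set M).

(** A negative [T] expresses that [p] attracts [L] in the past; then, because the
    attraction is uniform on [U], no orbit in [L] but that of [p] comes back to
    [U] at arbitrarily late times. *)
Record trap Xt L (p : M) U (T : R) : Prop := Trap {
  trap_open : open U;
  trap_self : U p;
  trap_time : T != 0;
  trap_stays : forall j q, L q -> U q -> U (Xt (j%:R * T) q);
  trap_attracts : forall W, nbhs p W -> exists J, forall j q,
    (J <= j)%N -> L q -> U q -> W (Xt (j%:R * T) q)
}.

Lemma trap_rev Xt L p U T : trap Xt L p U T ->
  trap (fun t => Xt (- t)) L p U (- T).
Proof.
move=> [oU Up T0 st at_]; split=> //; first by rewrite oppr_eq0.
  by move=> j q; rewrite mulrN opprK; exact: st.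
move=> W /at_ [J hJ]; exists J => j q; rewrite mulrN opprK; exact: hJ.
Qed.

(** If [T > 0], the orbit of [x], once in [U], converges to [p], which is thus the
    only limit point. If [T < 0], take a time [t + s k] at which the orbit of [x]
    is in [U]; [x] is obtained from there by going back for that long, so it is as
    close to [p] as one likes. *)
Lemma omega_limit_trap Xt L p U T x y t :
  (forall x, Xt 0 x = x) -> (forall s t x, Xt (s + t) x = Xt s (Xt t x)) ->
  (forall t, continuous (Xt t)) ->
  (forall W (r : R), nbhs p W ->
     \forall q \near p, forall s, `|s| <= r -> W (Xt s q)) ->
  (forall t q, L q -> L (Xt t q)) ->
  trap Xt L p U T -> L x ->
  (exists2 s : nat -> R, s @ \oo --> +oo & (fun k => Xt (s k) x) @ \oo --> y) ->
  U (Xt t y) -> y = p \/ x = p.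
Proof.
move=> X0 XD Xc Xn iL trapU Lx [s s_oo sy] Uty.
have in_U : \forall k \near \oo, U (Xt (t + s k) x).
  have ct : Xt t (Xt (s k) x) @[k --> \oo] --> Xt t y.
    exact: (cvg_comp _ _ sy (Xc t y)).
  have yU : nbhs (Xt t y) U.
    by apply: open_nbhs_nbhs; split=> //; exact: trap_open trapU.
  have h : \forall k \near \oo, U (Xt t (Xt (s k) x)) by exact: ct yU.
  by apply: filterS h => k; rewrite XD.
have large (A : R) : \forall k \near \oo, A <= s k.
  by have /cvgryPge := s_oo; exact.
have [T0|T0] : 0 < T \/ T < 0.
  by have := trap_time trapU; rewrite neq_lt => /orP [?|?]; [right|left].
- left; have [a Ua] : exists a, U (Xt a x).
    by have [k Uk] := filter_ex in_U; exists (t + s k).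
  suff sp : (fun k => Xt (s k) x) @ \oo --> p.
    exact: (cvg_unique hM sy sp).
  move=> W pW; have pW' := Xn W T pW.
  have [J hJ] := trap_attracts trapU pW'.
  have := large (J%:R * T + a); apply: filterS => k sk /=.
  have sk' : J%:R * T <= s k - a by rewrite lerBrDr.
  have [j [r [skE r0 rT Jj]]] := euclidean_time T0 sk'.
  have -> : s k = r + (j%:R * T + a) by rewrite addrCA addrA -skE subrK.
  rewrite !XD; apply: (hJ j _ Jj (iL a x Lx) Ua).
  by rewrite ger0_norm.
- right; apply: contrapT => xp.
  pose W := [set~ x].
  have pW : nbhs p W.
    apply: open_nbhs_nbhs; split; last exact/nesym.
    by apply: closed_openC; exact: accessible_closed_set1 (hausdorff_accessible hM) x.
  have pW' := Xn W (- T) pW.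
  have [J hJ] := trap_attracts trapU pW'.
  have [k [sk Uk]] : exists k, J%:R * (- T) - t <= s k /\ U (Xt (t + s k) x).
    exact: filter_ex (filterI (large _) in_U).
  have NT0 : 0 < - T by rewrite oppr_gt0.
  have sk' : J%:R * - T <= t + s k by rewrite -lerBlDl.
  have [j [r [skE r0 rT Jj]]] := euclidean_time NT0 sk'.
  have := hJ j _ Jj (iL _ x Lx) Uk (- r).
  rewrite normrN ger0_norm // => /(_ rT); rewrite /W /= -!XD; apply.
  have -> : - r + j%:R * T + (t + s k) = 0 by rewrite skE; ring.
  exact: X0.
Qed.

End Traps.

Section ContractionTrap.
Context (R : realType) (n : nat) (M : manifold R n) (Xt : R -> M -> M).
Local Notation V := 'rV[R]_n.

(** A small ball around [p] in its chart is a trap: the distance to [p] decreases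
    geometrically along the iterates. *)
Lemma contraction_trap (L : set M) (p : M) (T : R) :
  (forall x, Xt 0 x = x) -> (forall s t x, Xt (s + t) x = Xt s (Xt t x)) ->
  (forall t, continuous (Xt t)) ->
  (forall t q, L q -> L (Xt t q)) -> (forall t, Xt t p = p) -> T != 0 ->
  (\forall q \near p, L q ->
    `|chart p (Xt T q) - chart p p| <= 3 / 4 * `|chart p q - chart p p|) ->
  exists U : set M, trap Xt L p U T /\
    (forall q, L q -> U q -> Xt T q = q -> q = p).
Proof.
move=> X0 XD Xc iL fix_p T0 contr; have pp := dom_self p.
pose P q := dom p q /\ dom p (Xt T q) /\ (L q ->
  `|chart p (Xt T q) - chart p p| <= 3 / 4 * `|chart p q - chart p p|).
have near_P : \forall q \near p, P q.
  have : \forall q \near p, dom p (Xt T q).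
    by apply: Xc; rewrite fix_p; exact: near_dom.
  by move=> h; apply: filterS3 (near_dom pp) h contr.
have /nbhs_ballP [r /= r0 hr] := near_parm pp near_P.
pose U := [set q | dom p q /\ `|chart p q - chart p p| < r].
have UP q : U q -> P q.
  move=> [pq qr]; rewrite -(chartK pq); apply: hr.
  by rewrite -ball_normE /= distrC.
have stay j q : L q -> U q -> U (Xt (j%:R * T) q) /\
    `|chart p (Xt (j%:R * T) q) - chart p p| <= (3 / 4) ^+ j * r.
  move=> Lq Uq; elim: j => [|j [IHU IHr]].
    by rewrite mul0r X0 expr0 mul1r; split=> //; case: Uq => _ /ltW.
  rewrite -natr1 mulrDl mul1r addrC XD; set q' := Xt (j%:R * T) q in IHU IHr *.
  have [pq' [pTq' /(_ (iL _ _ Lq)) c]] := UP _ IHU.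
  have c' : `|chart p (Xt T q') - chart p p| <= (3 / 4) ^+ j.+1 * r.
    apply: (le_trans c); rewrite exprS -[leRHS]mulrA ler_pM2l //; lra.
  split=> //; split=> //; apply: (le_lt_trans c).
  have [_ q'r] := IHU.
  have := normr_ge0 (chart p q' - chart p p); lra.
exists U; split; last first.
  move=> q Lq Uq fq; have [pq [_ /(_ Lq)]] := UP _ Uq; rewrite fq => h.
  have /eqP : `|chart p q - chart p p| = 0.
    by have := normr_ge0 (chart p q - chart p p); lra.
  by rewrite normr_eq0 subr_eq0 => /eqP h'; rewrite -(chartK pq) h' chartK.
split=> //.
- rewrite openE => q [pq qr].
  have ct : `|chart p q' - chart p p| @[q' --> q] --> `|chart p q - chart p p|.
    by apply: cvg_norm; apply: cvgB; [exact: chart_cvg|exact: cvg_cst].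
  have lt_r : \forall q' \near q, `|chart p q' - chart p p| < r.
    exact: (cvgr_lt _ ct).
  by apply: filterS2 (near_dom pq) lt_r.
- by split=> //=; rewrite subrr normr0.
- by move=> j q Lq Uq; have [] := stay j q Lq Uq.
- move=> W pW; have /nbhs_ballP [d /= d0 hd] := near_parm pp pW.
  have lt1 : `|(3 / 4 : R)| < 1 by rewrite ger0_norm //; lra.
  have geo : \forall j \near \oo, `|0 - (3 / 4 : R) ^+ j| < d / r.
    by have /cvgrPdist_lt := cvg_expr lt1; apply; rewrite divr_gt0.
  have [J _ hJ] := geo; exists J => j q Jj Lq Uq.
  have [[pq _] jr] := stay j q Lq Uq.
  rewrite -(chartK pq); apply: hd; rewrite -ball_normE /= distrC.
  apply: (le_lt_trans jr); rewrite -ltr_pdivlMr //.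
  by have := hJ j Jj; rewrite /= sub0r normrN ger0_norm.
Qed.

End ContractionTrap.

(** * Hyperbolic singularities and restriction of bundles *)

Section Singularities.
Context (R : realType) (n : nat) (M : manifold R n) (g : riemannian_metric M).
Local Notation V := 'rV[R]_n.
Context (X : M -> V) (Xt : R -> M -> M).
Hypothesis XXt : tangent_flow X Xt.

(** A vector fixed by a time-[T] map is fixed by all its iterates, of both signs,
    while the iterates that go far into the future shrink it. *)
Lemma contracting_fixed_eq0 L (E : M -> {vspace V}) p T e :
  contracting g Xt L E -> L p -> (forall t, Xt t p = p) -> e \in E p ->
  T != 0 -> tangent_map (Xt T) p e = e -> e = 0.
Proof.
move=> [K [l [K0 l0 con]]] Lp fix_p Ee T0 De.
have [T' T'0 De'] : exists2 T', 0 < T' & tangent_map (Xt T') p e = e.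
  have [T1|T1] : 0 < T \/ T < 0.
    by move: T0; rewrite neq_lt => /orP [?|?]; [right|left].
    by exists T.
  exists (- T); first by rewrite oppr_gt0.
  by have := tflow_mapK XXt T p e; rewrite De fix_p.
have Dk (k : nat) : tangent_map (Xt (k%:R * T')) p e = e.
  elim: k => [|k IH]; first by rewrite mul0r (tflow_map0 XXt).
  by rewrite -natr1 mulrDl mul1r (tflow_mapD XXt) fix_p De' IH.
have [t t0 ht] := expR_unbounded (2 * K) l0.
pose k := (Num.truncn (t / T')).+1.
have kt : t <= k%:R * T'.
  have tT : 0 <= t / T' by rewrite divr_ge0 // ltW.
  have /andP [_ /ltW] := Num.Theory.truncn_itv tT.
  by rewrite ler_pdivrMr.
have kT0 : 0 <= k%:R * T' by rewrite mulr_ge0 // ltW.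
have := con p e _ Lp Ee kT0; rewrite fix_p Dk mulNr expRN.
have : 2 * K <= expR (l * (k%:R * T')).
  by apply: (le_trans ht); rewrite ler_expR ler_pM2l.
move: (expR _) (expR_gt0 (l * (k%:R * T'))) => A A0 hA.
rewrite mulrAC ler_pdivlMr // => h.
apply: (@tnorm_le0 _ _ _ g p); have := tnorm_ge0 g p e.
move: (tnorm g p e) h => b h b0.
rewrite -(pmulr_rle0 _ K0); nra.
Qed.

(** All areas in [C] vanish, so [C] is at most a line and [DX_T] multiplies it by
    a number [a]. Splitting a non-zero vector of [C] along the hyperbolic
    splitting at [p], whose flow direction is zero, [a] is also the multiplier on
    the stable part, and then it is small for large [T], or else the vector is
    unstable, and [a] is large for large [T], so its inverse at time [-T] is
    small. *)
Lemma center_rate (p : M) (C : {vspace V}) :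
  hyperbolic_singularity g X Xt p ->
  (forall t c, c \in C -> tangent_map (Xt t) p c \in C) ->
  (forall u v, u \in C -> v \in C -> area g p u v <= 0) ->
  exists2 T : R, T != 0
    & forall c, c \in C -> `|tangent_map (Xt T) p c| <= 1 / 2 * `|c|.
Proof.
move=> [Xp [[_ ip] [Es [Eu [K [l [[iEs _ iEu] dir [K0 l0] con exp]]]]]]] invC area0.
have fix_p t : Xt t p = p.
  have : (Xt t @` [set p]) (Xt t p) by exists p.
  by rewrite ip.
have [C0|C0] := pselect (forall c, c \in C -> c = 0).
  exists 1; first exact: oner_neq0.
  by move=> c /C0 ->; rewrite tangent_map0 normr0 mulr0.
have [c0 Cc0 c0n] : exists2 c, c \in C & c != 0.
  apply: contrapT => h; apply: C0 => c Cc; apply/eqP/negP => cn.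
  by apply: h; exists c => //; exact/negP.
have line c : c \in C -> exists a, c = a *: c0.
  move=> Cc; apply/vlineP.
  by apply: (area_eq0_line (g := g) (x := p)) => //; exact: area0.
have rate T a : T != 0 -> tangent_map (Xt T) p c0 = a *: c0 -> `|a| <= 1 / 2 ->
    exists2 T : R, T != 0
      & forall c, c \in C -> `|tangent_map (Xt T) p c| <= 1 / 2 * `|c|.
  move=> T0 Da a2; exists T => // _ /line [b ->].
  by rewrite tangent_mapZ Da scalerA mulrC -scalerA normrZ ler_wpM2r.
have [T T0 hT] := expR_unbounded (2 * K + 2) l0.
have Tn : T != 0.
  by apply/eqP => T00; move: hT; rewrite T00 mulr0 expR0; lra.
have [a Da] := line _ (invC T c0 Cc0).
have sp : [set p] p by [].
have [dirp fullp] := dir p sp.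
have : c0 \in (Es p + flow_direction X p + Eu p)%VS by rewrite fullp memvf.
move=> /memv_addP [_ /memv_addP [s Ess [x Xx ->]] [u Euu c0E]].
have x0 : x = 0.
  by move: Xx; rewrite /flow_direction Xp => /vlineP [k ->]; rewrite scaler0.
rewrite x0 addr0 in c0E.
have mem E v : invariant_subbundle Xt [set p] E -> v \in E p ->
    tangent_map (Xt T) p v \in E p.
  by move=> iE Ev; rewrite -{2}(fix_p T); exact: (invariant_subbundle_mem T iE).
have [] := directv3P dirp (a := tangent_map (Xt T) p s - a *: s) (b := 0)
  (c := tangent_map (Xt T) p u - a *: u).
- by rewrite memvB ?memvZ ?mem.
- exact: mem0v.
- by rewrite memvB ?memvZ ?mem.
- rewrite addr0 addrACA -opprD -scalerDr -c0E -Da c0E tangent_mapD.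
  exact: subrr.
move=> /eqP; rewrite subr_eq0 => /eqP Ds _ /eqP; rewrite subr_eq0 => /eqP Du.
have A0 := expR_gt0 (l * T).
have [s0|s0] := eqVneq s 0; last first.
  apply: (rate T a) => //.
  have := con p s T sp Ess T0; rewrite fix_p Ds tnormZ mulNr expRN.
  rewrite ler_pM2r ?tnorm_gt0 // => h.
  apply: (le_trans h); rewrite ler_pdivrMr //; lra.
have u0 : u != 0 by apply: contraNneq c0n => u0; rewrite c0E s0 u0 addr0.
have := exp p u T sp Euu T0; rewrite fix_p Du tnormZ.
rewrite ler_pM2r ?tnorm_gt0 // => h.
have a2 : 2 <= `|a|.
  by apply: (le_trans _ h); rewrite ler_pdivlMl //; lra.
have an : a != 0 by rewrite -normr_gt0; lra.
apply: (rate (- T) a^-1); rewrite ?oppr_eq0 //.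
  have := tflow_mapK XXt T p c0; rewrite fix_p Da tangent_mapZ => h1.
  by rewrite -[in RHS]h1 scalerA mulVf // scale1r.
by rewrite normfV; rewrite -[leLHS]mul1r ler_pdivrMr; lra.
Qed.

End Singularities.

Section Restriction.
Context (R : realType) (n : nat) (M : manifold R n).
Local Notation V := 'rV[R]_n.

Lemma subbundle_subset (L H : set M) (E : M -> {vspace V}) :
  H `<=` L -> subbundle L E -> subbundle H E.
Proof.
move=> HL sE x Hx; have [U [k [e [oU Ux Ud bE ce]]]] := sE x (HL x Hx).
exists U, k, e; split=> // [q Hq Uq|j]; first by apply: bE => //; exact: HL.
apply: continuous_subspaceW (ce j) => q [Hq Uq]; split=> //; exact: HL.
Qed.

Lemma invariant_subbundle_subset Xt (L H : set M) (E : M -> {vspace V}) :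
  H `<=` L -> invariant_subbundle Xt L E -> invariant_subbundle Xt H E.
Proof.
move=> HL [sE iE]; split; first exact: subbundle_subset sE.
by move=> x t Hx; apply: iE; exact: HL.
Qed.

Lemma invariant_subbundle_rev Xt (L : set M) (E : M -> {vspace V}) :
  invariant_subbundle (rev_flow Xt) L E -> invariant_subbundle Xt L E.
Proof.
by move=> [sE iE]; split=> // x t Lx; have := iE x (- t) Lx; rewrite /rev_flow opprK.
Qed.

(** Away from the singularities, the field itself is a continuous frame of the
    line that it spans. *)
Lemma flow_direction_invariant X Xt (H : set M) :
  C1_vector_field X -> tangent_flow X Xt -> (forall x, H x -> X x != 0) ->
  invariant_subbundle Xt H (flow_direction X).
Proof.
move=> C1X XXt HX; split=> [x Hx|x t Hx]; last first.
  apply/seteqP; split=> [_ /= [v + <-]|w /=].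
    move=> /vlineP [k ->]; rewrite tangent_mapZ (tflow_field XXt).
    by rewrite /flow_direction memvZ // memv_line.
  move=> /vlineP [k ->]; exists (k *: X x); first by rewrite memvZ // memv_line.
  by rewrite tangent_mapZ (tflow_field XXt).
exists [set q | dom x q /\ X q != 0], 1%N, (fun q => [tuple X q]).
split=> //.
- rewrite openE => q [xq Xq]; apply: filterS2 (near_dom xq) (regular_near C1X Xq).
  by [].
- by split; [exact: dom_self|exact: HX].
- by move=> q [].
- by move=> q Hq _; apply: seq1_basis; exact: HX.
- move=> j; apply/subspace_continuousP => q [_ [xq _]].
  apply: cvg_within_filter.
  rewrite (ord1 j).
  have := field_in_continuous C1X xq.
  exact.
Qed.

End Restriction.

(** * Sets sectional-hyperbolic in both directions *)

Section TwoSided.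
Context (R : realType) (n : nat) (M : manifold R n) (g : riemannian_metric M).
Local Notation V := 'rV[R]_n.
Context (X : M -> V) (Xt : R -> M -> M) (L : set M).
Hypotheses (cM : compact [set: M]) (C1X : C1_vector_field X)
  (XXt : induced_flow X Xt) (invL : compact_invariant Xt L).
Context (E F E' F' : M -> {vspace V}).
Hypotheses (EF : sectional_hyperbolic_splitting g Xt L E F)
  (EF' : sectional_hyperbolic_splitting g (rev_flow Xt) L E' F').

Let tf : tangent_flow X Xt := tangent_flow_induced XXt.
Let tf' : tangent_flow (rev_field X) (rev_flow Xt) := tangent_flow_rev tf.

Lemma field_mem_center x : L x -> X x \in F x /\ X x \in F' x.
Proof.
move=> Lx; have [B hB] := field_bounded C1X g cM; split.
  exact: (field_mem_center_unstable tf invL EF.1 hB Lx).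
have hB' y : tnorm g y (rev_field X y) <= B by rewrite tnormN.
have := field_mem_center_unstable tf' (compact_invariant_rev invL) EF'.1 hB' Lx.
by rewrite /rev_field memvN.
Qed.

Lemma stable_center_unstable_split x : L x ->
  directv (E x + (F x :&: F' x) + E' x)%VS /\
  (E x + (F x :&: F' x) + E' x)%VS = fullv.
Proof.
move=> Lx; have [[[_ _ dEF _] _] _] := EF; have [[[_ _ dEF' _] _] _] := EF'.
apply: center_directv; [exact: dEF|exact: dEF'| |].
  exact: (stable_sub_center tf invL EF.1 EF'.1 Lx).
apply: (stable_sub_center tf' (compact_invariant_rev invL) EF'.1 _ Lx).
by rewrite rev_flowK; exact: EF.1.
Qed.

Lemma center_area x u v : L x -> u \in (F x :&: F' x)%VS ->
  v \in (F x :&: F' x)%VS -> area g x u v <= 0.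
Proof.
have [[[_ iF _ _] _] eF] := EF; have [[[_ iF' _ _] _] eF'] := EF'.
exact: (area_center_eq0 tf invL iF eF iF' eF').
Qed.

Lemma center_flow_direction x : L x -> X x != 0 ->
  (F x :&: F' x)%VS = flow_direction X x.
Proof.
move=> Lx Xx; have [FX F'X] := field_mem_center Lx.
have CX : X x \in (F x :&: F' x)%VS by rewrite memv_cap FX.
apply/eqP; rewrite eqEsubv -memvE CX andbT; apply/subvP => v Cv.
by apply: area_eq0_line Xx (center_area Lx CX Cv).
Qed.

(** At regular points the line [C] is the flow direction, so the splitting
    [E + C + E'] is the hyperbolic one; expansion of [E'] is its contraction
    under the reversed flow. *)
Lemma hyperbolic_regular (H : set M) :
  compact_invariant Xt H -> H `<=` L -> (forall x, H x -> X x != 0) ->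
  hyperbolic_set g X Xt H.
Proof.
move=> iH HL HX; split=> //.
have [[[iE _ _ _] [K1 [l1 [K10 l10 con1]]]] _] := EF.
have [[[iE' _ _ _] [K2 [l2 [K20 l20 con2]]]] _] := EF'.
exists E, E', (Num.max K1 K2), (Num.min l1 l2); split.
- split; first exact: invariant_subbundle_subset iE.
    exact: flow_direction_invariant.
  by apply: invariant_subbundle_subset HL _; exact: invariant_subbundle_rev.
- move=> x Hx; have Lx := HL x Hx.
  rewrite -(center_flow_direction Lx (HX x Hx)).
  exact: stable_center_unstable_split.
- by rewrite lt_max K10 lt_min l10 l20.
- move=> x v t Hx Ev t0; apply: (le_trans (con1 x v t (HL x Hx) Ev t0)).
  rewrite ler_wpM2r ?tnorm_ge0 // ler_pM ?expR_ge0 //; first exact: ltW.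
    by rewrite le_max lexx.
  by rewrite ler_expR !mulNr lerN2 ler_wpM2r // ge_min lexx.
- move=> x v t Hx Ev t0; have Lx := HL x Hx.
  have Ey : tangent_map (Xt t) x v \in E' (Xt t x).
    exact: (invariant_subbundle_mem t (invariant_subbundle_rev iE') Lx Ev).
  have := con2 _ _ t (compact_invariant_mem t invL Lx) Ey t0.
  rewrite /rev_flow (tflowK tf) (tflow_mapK tf) mulNr expRN => h.
  have K0 : 0 < Num.max K1 K2 by rewrite lt_max K10.
  have h1 : expR (l2 * t) * tnorm g x v <=
      K2 * tnorm g (Xt t x) (tangent_map (Xt t) x v).
    by rewrite mulrC -ler_pdivlMr ?expR_gt0 //; move: h; rewrite mulrAC.
  rewrite -mulrA ler_pdivrMl //; apply: le_trans (le_trans h1 _).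
    rewrite ler_wpM2r ?tnorm_ge0 // ler_expR ler_wpM2r // ge_min lexx orbT //.
  by rewrite ler_wpM2r ?tnorm_ge0 // le_max lexx orbT.
Qed.

Lemma center_map_stable p t c : L p -> (forall t, Xt t p = p) ->
  c \in (F p :&: F' p)%VS -> tangent_map (Xt t) p c \in (F p :&: F' p)%VS.
Proof.
have [[[_ iF _ _] _] _] := EF; have [[[_ iF' _ _] _] _] := EF'.
move=> Lp fix_p; rewrite !memv_cap => /andP [Fc F'c].
rewrite -[p in F p](fix_p t) -[p in F' p](fix_p t).
rewrite (invariant_subbundle_mem t iF Lp Fc).
exact: (invariant_subbundle_mem t (invariant_subbundle_rev iF') Lp F'c).
Qed.

(** On the complement [E + E'] of [C p], which is preserved by [DX_T], the latter
    has no non-zero fixed vector. *)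
Lemma center_quotient_injective p T u : L p -> (forall t, Xt t p = p) -> T != 0 ->
  tangent_map (Xt T) p u - u \in (F p :&: F' p)%VS -> u \in (F p :&: F' p)%VS.
Proof.
move=> Lp fix_p T0 Cu.
have [[[iE _ _ _] cE] _] := EF; have [[[iE' _ _ _] cE'] _] := EF'.
have [dir full] := stable_center_unstable_split Lp.
have : u \in (E p + (F p :&: F' p) + E' p)%VS by rewrite full memvf.
move=> /memv_addP [_ /memv_addP [e Ee [c Cc ->]] [e' Ee' uE]].
have De : tangent_map (Xt T) p e \in E p.
  by rewrite -[p in E p](fix_p T); exact: (invariant_subbundle_mem T iE).
have De' : tangent_map (Xt T) p e' \in E' p.
  rewrite -[p in E' p](fix_p T).
  exact: (invariant_subbundle_mem T (invariant_subbundle_rev iE')).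
have [] := directv3P dir (a := tangent_map (Xt T) p e - e)
    (b := tangent_map (Xt T) p c - c - (tangent_map (Xt T) p u - u))
    (c := tangent_map (Xt T) p e' - e').
- by rewrite memvB.
- by rewrite memvB // memvB // center_map_stable.
- by rewrite memvB.
- rewrite uE !tangent_mapD.
  move: (tangent_map (Xt T) p e) (tangent_map (Xt T) p c)
    (tangent_map (Xt T) p e') => x y z.
  by apply/rowP => i; rewrite !mxE; ring.
move=> /eqP; rewrite subr_eq0 => /eqP fe _ /eqP; rewrite subr_eq0 => /eqP fe'.
have e0 : e = 0 by exact: (contracting_fixed_eq0 tf cE Lp fix_p Ee T0 fe).
have fe'V : tangent_map (rev_flow Xt T) p e' = e'.
  have := tflow_mapK tf T p e'; rewrite fe' fix_p; exact.
have fix_p' t : rev_flow Xt t p = p by exact: fix_p.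
have e'0 : e' = 0 by exact: (contracting_fixed_eq0 tf' cE' Lp fix_p' Ee' T0 fe'V).
by rewrite uE e0 e'0 add0r addr0.
Qed.

Lemma singularity_trap p : L p -> hyperbolic_singularity g X Xt p ->
  exists UT : set M * R, trap Xt L p UT.1 UT.2 /\
    (forall q, L q -> UT.1 q -> Xt UT.2 q = q -> q = p).
Proof.
move=> Lp hp; have fix_p t : Xt t p = p.
  have [_ [[_ ip] _]] := hp.
  have : (Xt t @` [set p]) (Xt t p) by exists p.
  by rewrite ip.
have [T T0 hT] := center_rate tf hp
  (fun t c => @center_map_stable p t c Lp fix_p)
  (fun u v => @center_area p u v Lp).
have [[[_ [sF _] _ _] _] _] := EF; have [[[_ [sF' _] _ _] _] _] := EF'.
have contr := local_contraction C1X XXt sF sF'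
  (fun t q Lq => compact_invariant_mem t invL Lq) field_mem_center Lp fix_p hp.1
  (fun u => center_quotient_injective Lp fix_p T0) hT.
have [U [trU uniqU]] := contraction_trap (flow0 XXt) (flowD XXt)
  (fun t => @flow_continuous_at _ _ _ _ _ XXt t)
  (fun t q Lq => compact_invariant_mem t invL Lq) fix_p T0 contr.
by exists (U, T).
Qed.

End TwoSided.

Theorem theorem2p4 (R : realType) (n : nat) (M : manifold R n)
    (g : riemannian_metric M) (X : M -> 'rV[R]_n) (Xt : R -> M -> M)
    (Lambda : set M) :
  compact [set: M] ->
  C1_vector_field X ->
  induced_flow X Xt ->
  compact_invariant Xt Lambda ->
  positively_sectional_hyperbolic g X Xt Lambda ->
  negatively_sectional_hyperbolic g X Xt Lambda ->
  exists H S Reg : set M,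
    [/\ Lambda = H `|` S `|` Reg,
        [/\ H `&` S = set0, H `&` Reg = set0 & S `&` Reg = set0],
        hyperbolic_set g X Xt H /\ H `&` singular X = set0,
        finite_set S /\ S `<=` singular X
      & Reg `<=` ~` singular X /\
        forall x, Reg x ->
          alpha_limit Xt x `<=` H `|` S /\ omega_limit Xt x `<=` H `|` S].
Proof.
move=> cM C1X XXt iL [_ hypS [E [F EF]]] [_ _ [E' [F' EF']]].
set L := Lambda in iL hypS EF EF' *.
have tf := tangent_flow_induced XXt.
have iLm t q : L q -> L (Xt t q) by exact: compact_invariant_mem.
have Xc t : continuous (Xt t) by exact: (@flow_continuous_at _ _ _ _ _ XXt t).
pose S := L `&` singular X.
have hypP p : S p -> hyperbolic_singularity g X Xt p.
  by move=> [Lp Xp]; exact: hypS.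
have fixS p : S p -> forall t, Xt t p = p.
  move=> /hypP [_ [[_ ip] _]] t.
  have : (Xt t @` [set p]) (Xt t p) by exists p.
  by rewrite ip.
have /choice [UT hUT] p : exists UT : set M * R, S p ->
    trap Xt L p UT.1 UT.2 /\
    (forall q, L q -> UT.1 q -> Xt UT.2 q = q -> q = p).
  have [Sp|nSp] := pselect (S p); last by exists (set0, 0).
  have [UT] := singularity_trap cM C1X XXt iL EF EF' Sp.1 (hypP p Sp).
  by exists UT.
have trS p (Sp : S p) := (hUT p Sp).1.
pose H := [set x | L x /\ forall t p, S p -> ~ (UT p).1 (Xt t x)].
pose Reg := [set x | L x /\ ~ H x /\ ~ S x].
have HL : H `<=` L by move=> x [].
have HX x : H x -> X x != 0.
  move=> [Lx hx]; apply/eqP => Xx; have Sx : S x by [].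
  by apply: (hx 0 x Sx); rewrite (flow0 XXt); exact: trap_self (trS x Sx).
have closedL : closed L by exact: compact_closed (@manifold_hausdorff _ _ M) iL.1.
have iH : compact_invariant Xt H.
  split.
    pose O := [set x | exists t p, S p /\ (UT p).1 (Xt t x)].
    have -> : H = L `&` ~` O.
      apply/seteqP; split=> x [Lx hx]; split=> //.
        by move=> [t [p [Sp]]]; exact: hx.
      by move=> t p Sp Ux; apply: hx; exists t, p.
    apply: (compact_closedI iL.1); apply: open_closedC.
    rewrite openE => x [t [p [Sp Ux]]].
    have nU : nbhs (Xt t x) (UT p).1.
      by apply: open_nbhs_nbhs; split=> //; exact: trap_open (trS p Sp).
    have nq : \forall q \near x, (UT p).1 (Xt t q) by exact: (Xc t x _ nU).
    by apply: filterS nq => q Uq; exists t, p.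
  move=> t; apply/seteqP; split=> [_ [x [Lx hx] <-]|x [Lx hx]].
    split; first exact: iLm.
    by move=> s p Sp; rewrite -(flowD XXt); exact: hx.
  exists (Xt (- t) x); last by rewrite -(flowD XXt) addrN (flow0 XXt).
  split; first exact: iLm.
  by move=> s p Sp; rewrite -(flowD XXt); exact: hx.
have limits Yt x y : Yt = Xt \/ Yt = rev_flow Xt -> L x -> ~ S x ->
    omega_limit Yt x y -> (H `|` S) y.
  move=> Ydef Lx nSx yx.
  have Ly : L y.
    have [s _ sy] := yx; apply: (closed_cvg L closedL _ _ sy).
    by apply: filterE => k; case: Ydef => ->; exact: iLm.
  apply: contrapT => /not_orP [nHy nSy].
  have [t [p [Sp Upy]]] : exists t p, S p /\ (UT p).1 (Xt t y).
    apply: contrapT => h; apply: nHy; split=> // t p Sp Upy.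
    by apply: h; exists t, p.
  have stays := fun W r pW => @flow_stays_near _ _ _ _ _ XXt p r W (fixS p Sp) pW.
  suff [yp|xp] : y = p \/ x = p.
  - by apply: nSy; rewrite yp.
  - by apply: nSx; rewrite xp.
  case: Ydef yx => -> yx.
    exact: (omega_limit_trap (@manifold_hausdorff _ _ M) (flow0 XXt) (flowD XXt)
      Xc stays iLm (trS p Sp) Lx yx Upy).
  apply: (omega_limit_trap (t := - t) (@manifold_hausdorff _ _ M) _ _ _ _ _
    (trap_rev (trS p Sp)) Lx yx).
  - by move=> z; rewrite oppr0 (flow0 XXt).
  - by move=> a b z; rewrite opprD (flowD XXt).
  - by move=> a; exact: Xc.
  - move=> W r pW; have := stays W r pW; apply: filterS => q h s sr.
    by apply: h; rewrite normrN.
  - by move=> a q; exact: iLm.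
  - by rewrite opprK.
exists H, S, Reg; split.
- apply/seteqP; split=> [x Lx|x [[[]|[]]|[]]] //.
  have [Hx|nHx] := pselect (H x); first by left; left.
  by have [Sx|nSx] := pselect (S x); [left; right|right].
- split; apply/seteqP; split=> // x [].
  + by move=> /HX Xx [_ Sx]; move: Xx; rewrite Sx eqxx.
  + by move=> Hx [_ [nHx _]].
  + by move=> Sx [_ [_ nSx]].
- split; first exact: (hyperbolic_regular cM C1X XXt iL EF EF' iH HL HX).
  by apply/seteqP; split=> // x [/HX Xx Sx]; move: Xx; rewrite Sx eqxx.
- split; last by move=> x [].
  apply: (compact_discrete_finite iL.1); first by move=> x [].
  move=> x Lx; have [Xx|Xx] := eqVneq (X x) 0; last first.
    have := regular_near C1X Xx; apply: filterS => y Xy [_ Sy].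
    by move: Xy; rewrite Sy eqxx.
  have Sx : S x by [].
  have nU : nbhs x (UT x).1.
    apply: open_nbhs_nbhs; split; first exact: trap_open (trS x Sx).
    exact: trap_self (trS x Sx).
  apply: filterS nU => y Uy Sy.
  by apply: (hUT x Sx).2 Uy _ => //; [exact: Sy.1|exact: fixS].
- split=> [x [Lx [_ nSx]] Xx|x [Lx [_ nSx]]]; first by apply: nSx.
  split=> y; first exact: limits (or_intror erefl) Lx nSx.
  exact: limits (or_introl erefl) Lx nSx.
Qed.
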